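(* Let $m,n\ge1$ and let $U\subseteq\{\mathbf q\in\mathbb C^m:\max_i|q_i|<1\}$ be open. Let $H(\mathbf t,\mathbf y;\mathbf q)=(H_1,\dots,H_n)$ be such that for every $\mathbf q_0\in U$, $H$ is holomorphic at $(\mathbf t,\mathbf y,\mathbf q)=(\mathbf 0,\mathbf 0,\mathbf q_0)$ with $H(\mathbf 0,\mathbf 0;\mathbf q_0)=\mathbf 0$. Suppose that for every $\mathbf q\in U$ no eigenvalue of $D(\mathbf q)=\big(\frac{\partial H_j}{\partial y_k}(\mathbf 0,\mathbf 0;\mathbf q)\big)_{j,k}$ lies in $Q_0=\{0\}\cup\{\mathbf q^\alpha:\alpha\in\mathbb N^m\setminus\{0\}\}$. Then for every $\mathbf q\in U$ the system $y_j(q_1t_1,\dots,q_mt_m;\mathbf q)=H_j(\mathbf t,\mathbf y(\mathbf t;\mathbf q);\mathbf q)$ ($1\le j\le n$) has a unique convergent power series solution $y_j(\mathbf t;\mathbf q)=\sum_{\alpha\in\mathbb N^m\setminus\{0\}}b^{(j)}_\alpha(\mathbf q)\mathbf t^\alpha$ vanishing at $\mathbf t=\mathbf 0$, and for every $\mathbf q_0\in U$ there are open neighbourhoods $Z\subseteq\mathbb C^m$ of $\mathbf 0$ and $V\subseteq U$ of $\mathbf q_0$ such that these series converge uniformly on $Z\times V$ in $(\mathbf t,\mathbf q)$, defining holomorphic functions there.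
   Context: Multi-index notation: for $\alpha\in\mathbb N^m$, $\mathbf q^\alpha=q_1^{\alpha_1}\cdots q_m^{\alpha_m}$ and $\mathbf t^\alpha=t_1^{\alpha_1}\cdots t_m^{\alpha_m}$. *)

(* Defs.v *)
From mathcomp Require Import all_boot all_algebra.
From mathcomp Require Import reals.
From mathcomp Require Export complex.
Set Implicit Arguments. Unset Strict Implicit. Unset Printing Implicit Defensive.
Import GRing.Theory Num.Theory.
Local Open Scope ring_scope.

Section Defs.
Variable R : realType.
Local Notation C := R[i].

Definition zerov {I : Type} : I -> C := fun _ => 0.

Definition multi_pow (I : finType) (z : I -> C) (a : I -> nat) : C :=
  \prod_(i : I) z i ^+ a i.

Definition box_sum (I : finType) (c : (I -> nat) -> C) (z : I -> C) (N : nat) : C :=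
  \sum_(a : {ffun I -> 'I_N}) c (fun i => nat_of_ord (a i)) *
                              multi_pow z (fun i => nat_of_ord (a i)).

Definition abs_box_sum (I : finType) (c : (I -> nat) -> C) (z : I -> C) (N : nat) : C :=
  \sum_(a : {ffun I -> 'I_N}) `|c (fun i => nat_of_ord (a i))| *
                              `|multi_pow z (fun i => nat_of_ord (a i))|.

Definition ps_converges_to (I : finType) (c : (I -> nat) -> C) (z : I -> C) (l : C) : Prop :=
  (exists M : C, forall N, abs_box_sum c z N <= M) /\
  (forall e : C, 0 < e -> exists N0 : nat, forall N : nat, (N0 <= N)%N ->
      `|box_sum c z N - l| < e).

Definition in_polydisc (I : finType) (p z : I -> C) (r : C) : Prop :=
  forall i, `|z i - p i| < r.

Definition open_set (I : finType) (S : (I -> C) -> Prop) : Prop :=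
  forall p, S p -> exists r : C, 0 < r /\ forall z, in_polydisc p z r -> S z.

Definition holomorphic_at (I : finType) (f : (I -> C) -> C) (p : I -> C) : Prop :=
  exists (c : (I -> nat) -> C) (r : C), 0 < r /\
    forall z, in_polydisc p z r -> ps_converges_to c (fun i => z i - p i) (f z).

(* the component H_j seen as a function of the joint variable (t, y, q) *)
Definition H3 (m n : nat)
  (H : ('I_m -> C) -> ('I_n -> C) -> ('I_m -> C) -> 'I_n -> C) (j : 'I_n)
  (w : (('I_m + 'I_n) + 'I_m)%type -> C) : C :=
  H (fun i => w (inl (inl i))) (fun k => w (inl (inr k))) (fun i => w (inr i)) j.

Definition join3 (m n : nat) (t : 'I_m -> C) (y : 'I_n -> C) (q : 'I_m -> C)
  : (('I_m + 'I_n) + 'I_m)%type -> C :=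
  fun w => match w with
           | inl (inl i) => t i
           | inl (inr k) => y k
           | inr i => q i
           end.

Definition is_partial_y (m n : nat)
  (H : ('I_m -> C) -> ('I_n -> C) -> ('I_m -> C) -> 'I_n -> C)
  (q : 'I_m -> C) (j k : 'I_n) (d : C) : Prop :=
  forall e : C, 0 < e -> exists delta : C, 0 < delta /\
    forall h : C, 0 < `|h| < delta ->
      `|(H (zerov) (fun l => if l == k then h else 0) q j
          - H (zerov) (zerov) q j) / h - d| < e.

Definition in_Q0 (m : nat) (q : 'I_m -> C) (lam : C) : Prop :=
  lam = 0 \/ exists a : 'I_m -> nat, (exists i, a i <> 0%N) /\ lam = multi_pow q a.

Definition is_solution (m n : nat)
  (H : ('I_m -> C) -> ('I_n -> C) -> ('I_m -> C) -> 'I_n -> C)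
  (q : 'I_m -> C) (b : 'I_n -> ('I_m -> nat) -> C) : Prop :=
  (forall j, b j (fun _ => 0%N) = 0) /\
  exists (r : C) (Y : 'I_n -> ('I_m -> C) -> C), 0 < r /\
    forall t : 'I_m -> C, in_polydisc (zerov) t r ->
      (forall j, ps_converges_to (b j) t (Y j t)) /\
      (forall j, Y j (fun i => q i * t i) = H t (fun k => Y k t) q j).

End Defs.
Arguments zerov {R I}.

(* Main.v *)
(** Everything takes place in algebras of absolutely summable power series on a
closed unit polydisc, normed by the sum of the moduli of the coefficients.
After rescaling, write [q = q0 + s] and treat [s] as further variables.  If [c']
is [H] without its terms linear in [y] alone, the equation for the joint power
series [y(t, s)] reads, coefficient by coefficient,
  [(q0^a - D(q0)) y_a = (c'(t, y, s) - (y((q0 + s) t, s) - y(q0 t, s)))_a].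
Since [q0^a] tends to [0] and [D(q0)] is invertible, the matrices
[(q0^a - D(q0))^-1] with [a <> 0] are uniformly bounded, and the right-hand side
has a small Lipschitz constant in [y] once the radii are small, so that the
contraction principle yields a solution holomorphic in [t] and [q] together.  The same
estimate at fixed [q], together with the identity theorem, gives uniqueness.
Substituting series of norm at most [1] into a series commutes with evaluation; this
one fact provides recentring, restriction to fixed [q] and [y((q0 + s) t, s)]. *)
Require Import Defs.
From mathcomp Require Import all_boot all_order all_algebra.
From mathcomp Require Import boolp classical_sets reals complex.
From mathcomp Require Import ring lra.
Set Implicit Arguments. Unset Strict Implicit. Unset Printing Implicit Defensive.
Import Order.TTheory GRing.Theory Num.Theory.
Import Normc.
Local Open Scope ring_scope.


(** * Real-valued modulus of complex numbers *)

Section ComplexNorm.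
Variable R : realType.
Implicit Types (x y z : R[i]) (r : R).

(** Solving jointly in [t] and [s] brings in the resolvents at [q0] alone and builds holomorphy in
    [q] into the unknown. The price is the term [y((q0 + s) t, s) - y(q0 t, s)], which must be small
    as an operator on whole series. A monomial of degree [k] in [t] changes by about
    [k s theta^(k-1)], where [theta < 1] bounds [|q0| + s]; since
    [k theta^(k-1) <= 1 / (1 - theta)], the operator norm is at most [s / (1 - theta)], with no loss
    of radius. Coefficients free of [t] are special: their multiplier is [q0^0 = 1], which may be an
    eigenvalue. They are prescribed to be [0], and [H(0, 0; q) = 0] makes the equation hold there. A
    given solution need not lie in the small ball on which the contraction estimate holds.
    Uniqueness therefore first shrinks [t]: the vanishing constant term makes the norm at most
    proportional to the radius. Sums are unordered, over arbitrary index types, so that every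
    rearrangement is an instance of Fubini's theorem. *)

Lemma normcE_real z : `|z| = (normc z)%:C%C.
Proof. by case: z. Qed.

Lemma normc_ge0 z : 0 <= normc z.
Proof. by case: z => a b; exact: sqrtr_ge0. Qed.

Lemma normc_real r : normc r%:C%C = `|r|.
Proof. by rewrite /normc /= expr0n /= addr0 sqrtr_sqr. Qed.

Lemma normc_real_ge0 r : 0 <= r -> normc r%:C%C = r.
Proof. by move=> r0; rewrite normc_real ger0_norm. Qed.

Lemma normcB z y : normc (z - y) <= normc z + normc y.
Proof. by rewrite -(normcN y); exact: le_normcD. Qed.

Lemma normcX z k : normc (z ^+ k) = normc z ^+ k.
Proof. by elim: k => [|k IH]; rewrite ?normc1 // !exprS normcM IH. Qed.

Lemma normc_sum (I : Type) (s : seq I) (f : I -> R[i]) :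
  normc (\sum_(i <- s) f i) <= \sum_(i <- s) normc (f i).
Proof.
elim: s => [|i s IH]; first by rewrite !big_nil normc0.
by rewrite !big_cons (le_trans (le_normcD _ _)) // lerD2l.
Qed.

Lemma ge0_complexE z : 0 <= z -> z = (complex.Re z)%:C%C.
Proof. by move=> z0; rewrite RRe_real // realE z0. Qed.

Lemma gt0_complexE z : 0 < z -> z = (complex.Re z)%:C%C /\ 0 < complex.Re z.
Proof.
move=> z0; have E := ge0_complexE (ltW z0); split=> //.
by move: z0; rewrite {1}E ltcR.
Qed.

(** Replaces a sum of moduli by a linear combination with weights of modulus at most one; the weight
    [0] serves [z = 0]. *)
Lemma unimodular_normc z : exists u, normc u <= 1 /\ u * z = (normc z)%:C%C.
Proof.
have [->|z0] := eqVneq z 0; first by exists 0; rewrite !normc0 mul0r.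
have nz : normc z != 0 by apply: contra_neq z0; exact: eq0_normc.
exists ((normc z)%:C%C / z); split; last by rewrite mulfVK.
by rewrite normcM normcV normc_real_ge0 ?normc_ge0 // divff.
Qed.

Lemma normc_eq0_small z : (forall e, 0 < e -> normc z <= e) -> z = 0.
Proof.
move=> h; apply: eq0_normc; apply/eqP; rewrite eq_le normc_ge0 andbT.
by apply/ler_addgt0Pl => e e0; rewrite addr0; exact: h.
Qed.
End ComplexNorm.

(** * Unordered absolutely convergent sums and Fubini's theorem *)

Section Sums.
Variable R : realType.
Local Notation C := R[i].

Definition sum_bound (T : eqType) (g : T -> R) (K : R) : Prop :=
  forall s : seq T, uniq s -> \sum_(t <- s) g t <= K.

Definition l1_bound (T : eqType) (f : T -> C) (K : R) : Prop :=
  sum_bound (fun t => normc (f t)) K.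

Definition has_sum (T : eqType) (f : T -> C) (a : C) : Prop :=
  forall e : R, 0 < e -> exists2 s0 : seq T, uniq s0 &
    forall s, uniq s -> {subset s0 <= s} -> normc (\sum_(t <- s) f t - a) <= e.

(* Junk value [0] when [f] has no sum. *)
Definition total (T : eqType) (f : T -> C) : C := xget 0 (has_sum f).

Lemma big_uniq_sub (V : nmodType) (T : eqType) (s0 s : seq T) (f : T -> V) :
  uniq s0 -> uniq s -> {subset s0 <= s} ->
  \sum_(t <- s) f t = \sum_(t <- s0) f t + \sum_(t <- s | t \notin s0) f t.
Proof.
move=> u0 u sub; rewrite (bigID (mem s0)) /=; congr (_ + _).
rewrite -big_filter; apply: perm_big; apply: uniq_perm => //.
  exact: filter_uniq.
by move=> t; rewrite mem_filter andb_idr // => /sub.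
Qed.

Section OneFamily.
Variable T : eqType.
Implicit Types (f g : T -> C) (h : T -> R) (s : seq T) (K : R).

Lemma sum_bound_ge0 h K : sum_bound h K -> 0 <= K.
Proof. by move/(_ [::] isT); rewrite big_nil. Qed.

Lemma l1_bound_ge0 f K : l1_bound f K -> 0 <= K.
Proof. exact: sum_bound_ge0. Qed.

Lemma sum_bound_le h h' K K' :
  sum_bound h K -> (forall t, h' t <= h t) -> K <= K' -> sum_bound h' K'.
Proof.
move=> hK hh KK s us; apply: le_trans KK; apply: le_trans (hK s us).
by apply: ler_sum => t _.
Qed.

Lemma l1_bound_le f g K K' :
  l1_bound f K -> (forall t, normc (g t) <= normc (f t)) -> K <= K' ->
  l1_bound g K'.
Proof. exact: sum_bound_le. Qed.

Lemma l1_boundW f K K' : l1_bound f K -> K <= K' -> l1_bound f K'.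
Proof. by move=> h; apply: l1_bound_le h _. Qed.

Lemma l1_boundD f g K K' :
  l1_bound f K -> l1_bound g K' -> l1_bound (fun t => f t + g t) (K + K').
Proof.
move=> fK gK s us; apply: le_trans (lerD (fK s us) (gK s us)).
by rewrite -big_split; apply: ler_sum => t _; exact: le_normcD.
Qed.

Lemma l1_boundB f g K K' :
  l1_bound f K -> l1_bound g K' -> l1_bound (fun t => f t - g t) (K + K').
Proof.
move=> fK gK s us; apply: le_trans (lerD (fK s us) (gK s us)).
by rewrite -big_split; apply: ler_sum => t _; exact: normcB.
Qed.

Lemma l1_boundZ (c : C) f K :
  l1_bound f K -> l1_bound (fun t => c * f t) (normc c * K).
Proof.
move=> fK s us; under eq_bigr do rewrite normcM.
by rewrite -mulr_sumr ler_wpM2l ?normc_ge0 // fK.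
Qed.

Lemma l1_bound0 : l1_bound (fun _ : T => 0 : C) 0.
Proof. by move=> s _; rewrite big1 // => t _; rewrite normc0. Qed.

Lemma l1_bound_at f K t : l1_bound f K -> normc (f t) <= K.
Proof. by move/(_ [:: t] isT); rewrite big_seq1. Qed.

Lemma l1_bound_sum (I : Type) (r : seq I) (F : I -> T -> C) (k : I -> R) :
  (forall i, l1_bound (F i) (k i)) ->
  l1_bound (fun t => \sum_(i <- r) F i t) (\sum_(i <- r) k i).
Proof.
move=> FK; elim: r => [|i r IH].
  by rewrite big_nil => s us; rewrite big1 // => t _; rewrite big_nil normc0.
rewrite big_cons; apply: l1_bound_le (l1_boundD (FK i) IH) _ _ => // t.
by rewrite big_cons.
Qed.

Lemma l1_bound_support1 f t0 :
  (forall t, t != t0 -> f t = 0) -> l1_bound f (normc (f t0)).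
Proof.
move=> f0 s us; have [t0s|t0s] := boolP (t0 \in s).
  rewrite (bigD1_seq t0) //= big1 ?addr0 // => t tt0.
  by rewrite f0 ?normc0.
rewrite big_seq big1 ?normc_ge0 // => t ts; rewrite f0 ?normc0 //.
by apply: contraNneq t0s => <-.
Qed.

Lemma l1_bound_eq0 f : (forall e, 0 < e -> l1_bound f e) -> forall t, f t = 0.
Proof.
by move=> h t; apply: normc_eq0_small => e e0; exact: l1_bound_at (h e e0).
Qed.

Lemma has_sum_uniq f a b : has_sum f a -> has_sum f b -> a = b.
Proof.
move=> fa fb; apply/eqP; rewrite -subr_eq0; apply/eqP.
apply: normc_eq0_small => e e0.
have e2 : 0 < e / 2 by rewrite divr_gt0.
have [sa ua ha] := fa _ e2; have [sb ub hb] := fb _ e2.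
have us := undup_uniq (sa ++ sb).
have := ha _ us; have := hb _ us.
have sub1 : {subset sb <= undup (sa ++ sb)}.
  by move=> x xs; rewrite mem_undup mem_cat xs orbT.
have sub2 : {subset sa <= undup (sa ++ sb)}.
  by move=> x xs; rewrite mem_undup mem_cat xs.
move=> /(_ sub1) h1 /(_ sub2) h2; rewrite (splitr e).
set S := \sum_(_ <- _) _ in h1 h2.
have -> : a - b = (S - b) - (S - a) by ring.
by apply: le_trans (normcB _ _) _; rewrite lerD.
Qed.

Lemma has_sum_total f a : has_sum f a -> total f = a.
Proof. by move=> fa; apply: (has_sum_uniq _ fa); exact: (@xgetI _ 0 _ a fa). Qed.

Lemma has_sumD f g a b : has_sum f a -> has_sum g b ->
  has_sum (fun t => f t + g t) (a + b).
Proof.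
move=> fa gb e e0; have e2 : 0 < e / 2 by rewrite divr_gt0.
have [sa ua ha] := fa _ e2; have [sb ub hb] := gb _ e2.
exists (undup (sa ++ sb)); first exact: undup_uniq.
move=> s us sub; rewrite big_split /= (splitr e).
set A := \sum_(_ <- _) _; set B := \sum_(_ <- _) _.
have -> : A + B - (a + b) = (A - a) + (B - b) by ring.
apply: le_trans (le_normcD _ _) _; apply: lerD; [apply: ha|apply: hb] => // t ts.
  by apply: sub; rewrite mem_undup mem_cat ts.
by apply: sub; rewrite mem_undup mem_cat ts orbT.
Qed.

Lemma has_sumZ c f a : has_sum f a -> has_sum (fun t => c * f t) (c * a).
Proof.
move=> fa e e0; have k0 : 0 < normc c + 1 by rewrite ltr_wpDl ?normc_ge0.
have [sa ua ha] := fa (e / (normc c + 1)) (divr_gt0 e0 k0).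
exists sa => // s us sub; rewrite -mulr_sumr -mulrBr normcM.
apply: le_trans (ler_wpM2l (normc_ge0 _) (ha s us sub)) _.
rewrite mulrCA ger_pMr // ler_pdivrMr // mul1r lerDl //.
Qed.

Lemma has_sum_ge0 h K : (forall t, 0 <= h t) -> sum_bound h K ->
  exists a, has_sum (fun t => (h t)%:C%C) a.
Proof.
move=> h0 hK; pose E := [set x | exists2 s : seq T, uniq s & x = \sum_(t <- s) h t]%classic.
have E0 : has_sup E.
  split; first by exists 0, [::]; rewrite ?big_nil.
  by exists K => _ [s us ->]; exact: hK.
exists (sup E)%:C%C => e e0; have [_ [s0 u0 ->] lt0] := sup_adherent e0 E0.
exists s0 => // s us sub; rewrite -rmorph_sum -rmorphB normc_real.
have Es : \sum_(t <- s) h t <= sup E by apply: sup_upper_bound => //; exists s.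
have : \sum_(t <- s0) h t <= \sum_(t <- s) h t.
  by rewrite [leRHS](big_uniq_sub _ u0 us sub) lerDl sumr_ge0.
by rewrite ler0_norm ?subr_le0 //; lra.
Qed.

Lemma has_sum_real h K : sum_bound (fun t => `|h t|) K ->
  exists a, has_sum (fun t => (h t)%:C%C) a.
Proof.
move=> hK.
(* [h] is the difference of the nonnegative families [h + |h|] and [|h|]. *)
have [a ha] : exists a, has_sum (fun t => (h t + `|h t|)%:C%C) a.
  apply: (@has_sum_ge0 _ (K + K)) => [t|s us].
    by have := ler_norm (- h t); rewrite normrN; lra.
  apply: le_trans (lerD (hK s us) (hK s us)).
  by rewrite -big_split; apply: ler_sum => t _; rewrite lerD2r ler_norm.
have [b hb] := has_sum_ge0 (fun t => normr_ge0 (h t)) hK.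
exists (a + (-1) * b); move: (has_sumD ha (has_sumZ (-1) hb)).
congr has_sum; apply: funext => t.
by rewrite rmorphD /= mulN1r addrK.
Qed.

Lemma normc_Re (z : C) : `|complex.Re z| <= normc z.
Proof.
by case: z => a b /=; rewrite -[leLHS]sqrtr_sqr ler_wsqrtr // lerDl sqr_ge0.
Qed.

Lemma normc_Im (z : C) : `|complex.Im z| <= normc z.
Proof.
by case: z => a b /=; rewrite -[leLHS]sqrtr_sqr ler_wsqrtr // lerDr sqr_ge0.
Qed.

Lemma has_sum_l1 f K : l1_bound f K -> has_sum f (total f).
Proof.
move=> fK.
have [a ha] := has_sum_real (sum_bound_le fK (fun t => normc_Re (f t)) (lexx _)).
have [b hb] := has_sum_real (sum_bound_le fK (fun t => normc_Im (f t)) (lexx _)).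
have : has_sum f (a + 'i%C * b).
  move: (has_sumD ha (has_sumZ 'i%C hb)); congr has_sum; apply: funext => t.
  by rewrite [RHS]complexE.
by move=> h; rewrite (has_sum_total h).
Qed.

Lemma totalD f g K K' : l1_bound f K -> l1_bound g K' ->
  total (fun t => f t + g t) = total f + total g.
Proof.
by move=> /has_sum_l1 a /has_sum_l1 b; apply: has_sum_total; exact: has_sumD.
Qed.

Lemma totalZ c f K : l1_bound f K -> total (fun t => c * f t) = c * total f.
Proof. by move=> /has_sum_l1 a; apply: has_sum_total; exact: has_sumZ. Qed.

Lemma totalB f g K K' : l1_bound f K -> l1_bound g K' ->
  total (fun t => f t - g t) = total f - total g.
Proof.
move=> a b; have := totalD a (l1_boundZ (-1) b).
rewrite (totalZ _ b) mulN1r => <-; congr total; apply: funext => t.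
by rewrite mulN1r.
Qed.

Lemma total_sum (I : Type) (r : seq I) (F : I -> T -> C) (k : I -> R) :
  (forall i, l1_bound (F i) (k i)) ->
  total (fun t => \sum_(i <- r) F i t) = \sum_(i <- r) total (F i).
Proof.
move=> FK; elim: r => [|i r IH].
  rewrite big_nil; apply: has_sum_total => e e0; exists [::] => // s _ _.
  by rewrite big1 ?subr0 ?normc0 ?ltW // => t _; rewrite big_nil.
rewrite big_cons -IH -(totalD (FK i) (l1_bound_sum r FK)).
by congr total; apply: funext => t; rewrite big_cons.
Qed.

Lemma normc_total f K : l1_bound f K -> normc (total f) <= K.
Proof.
move=> fK; apply/ler_addgt0Pl => e e0; have [s us hs] := has_sum_l1 fK e0.
have := hs s us (fun _ => id); set S := \sum_(_ <- _) _ => h.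
have -> : total f = S - (S - total f) by rewrite subKr.
rewrite [leRHS]addrC; apply: le_trans (normcB _ _) _; apply: lerD => //.
exact: le_trans (normc_sum _ _) (fK s us).
Qed.

Lemma total_support f s : uniq s -> (forall t, t \notin s -> f t = 0) ->
  total f = \sum_(t <- s) f t.
Proof.
move=> us f0; apply: has_sum_total => e e0; exists s => // s' us' sub.
rewrite (big_uniq_sub _ us us' sub) addrAC subrr add0r big1 ?normc0 ?ltW //.
Qed.

Lemma total_support1 f t0 : (forall t, t != t0 -> f t = 0) -> total f = f t0.
Proof.
move=> f0; rewrite (@total_support f [:: t0]) ?big_seq1 // => t.
by rewrite inE; exact: f0.
Qed.

Lemma total0 f : (forall t, f t = 0) -> total f = 0.
Proof. by move=> f0; rewrite (@total_support f [::]) ?big_nil. Qed.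

(** A finite set whose sum of moduli is within [e] of the supremum leaves less than [e] for any
    finite set disjoint from it. *)
Lemma l1_bound_tail f K : l1_bound f K -> forall e : R, 0 < e ->
  exists2 s, uniq s & l1_bound (fun t => if t \in s then 0 else f t) e.
Proof.
move=> fK e e0; pose E := [set x | exists2 s : seq T, uniq s & x = \sum_(t <- s) normc (f t)]%classic.
have E0 : has_sup E.
  split; first by exists 0, [::]; rewrite ?big_nil.
  by exists K => _ [s us ->]; exact: fK.
have [_ [s0 u0 ->] lt0] := sup_adherent e0 E0.
exists s0 => // s us; pose u := s0 ++ [seq t <- s | t \notin s0].
have uu : uniq u.
  rewrite cat_uniq u0 filter_uniq // andbT -all_predC.
  by apply/allP => t; rewrite mem_filter => /andP[].
have : \sum_(t <- u) normc (f t) <= sup E by apply: sup_upper_bound => //; exists u.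
rewrite big_cat big_filter /= => le0.
rewrite (bigID (mem s0)) /= big1 ?add0r; last by move=> t ->; rewrite normc0.
under eq_bigr => t /negPf -> do [].
lra.
Qed.
End OneFamily.

Section TwoFamilies.
Variables T1 T2 : eqType.
Implicit Types (F : T1 * T2 -> C).

(** Grouping a finite set of pairs by first coordinate leaves a duplicate-free list of second
    coordinates in each row. *)
Lemma sum_bound_pair (h : T1 * T2 -> R) (g : T1 -> R) K :
  (forall i, sum_bound (fun j => h (i, j)) (g i)) -> sum_bound g K -> sum_bound h K.
Proof.
move=> hg gK s us; apply: le_trans (gK (undup (map fst s)) (undup_uniq _)).
have -> : \sum_(p <- s) h p = \sum_(p <- s) \sum_(i <- undup (map fst s) | i == p.1) h p.
  rewrite big_seq [RHS]big_seq; apply: eq_bigr => p ps.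
  rewrite -big_filter (@perm_big _ _ _ _ _ [:: p.1]) ?big_seq1 //.
  apply: uniq_perm => //; first by rewrite filter_uniq ?undup_uniq.
  move=> i; rewrite mem_filter inE andb_idr // => /eqP ->.
  by rewrite mem_undup map_f.
rewrite (exchange_big_dep predT) //=; apply: ler_sum => i _.
have -> : \sum_(p <- s | i == p.1) h p
    = \sum_(j <- map snd [seq p <- s | i == p.1]) h (i, j).
  rewrite big_map big_filter; apply: eq_bigr => -[a b] /= /eqP -> //.
apply: hg; rewrite map_inj_in_uniq ?filter_uniq //.
move=> [a b] [a' b']; rewrite !mem_filter /= => /andP[/eqP <- _] /andP[/eqP <- _].
by move=> ->.
Qed.

Lemma l1_bound_pair F (g : T1 -> R) K :
  (forall i, l1_bound (fun j => F (i, j)) (g i)) -> sum_bound g K -> l1_bound F K.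
Proof. exact: sum_bound_pair. Qed.

Lemma l1_bound_row F K i : l1_bound F K -> l1_bound (fun j => F (i, j)) K.
Proof.
move=> FK s us; apply: le_trans (FK (map (pair i) s) _); first by rewrite big_map.
by rewrite map_inj_uniq // => a b [].
Qed.

Lemma l1_bound_swap F K : l1_bound F K -> l1_bound (fun p => F (p.2, p.1)) K.
Proof.
move=> FK s us; apply: le_trans (FK (map (fun p => (p.2, p.1)) s) _); first by rewrite big_map.
by rewrite map_inj_uniq // => -[a b] [a' b'] [-> ->].
Qed.

(* Multiplying row [i] by a unimodular [u i] turns the sum of the moduli of the row sums
   into the sum of one summable family. *)
Lemma l1_bound_marginal F K : l1_bound F K ->
  l1_bound (fun i => total (fun j => F (i, j))) K.
Proof.
move=> FK s us; have [u hu] := choice (fun i => unimodular_normc (total (fun j => F (i, j)))).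
pose G j := \sum_(i <- s) u i * F (i, j).
have GK : l1_bound G K.
  move=> r ur; apply: le_trans (FK [seq (i, j) | i <- s, j <- r] _).
    rewrite big_allpairs exchange_big /=; apply: ler_sum => j _.
    apply: le_trans (normc_sum _ _) _; apply: ler_sum => i _.
    by rewrite normcM ler_piMl ?normc_ge0 //; case: (hu i).
  by apply: allpairs_uniq => // -[a b] [a' b'] _ _ [-> ->].
rewrite -[leLHS]normc_real_ge0; last by rewrite sumr_ge0 // => i _; exact: normc_ge0.
rewrite rmorph_sum /=.
have -> : \sum_(i <- s) (normc (total (fun j => F (i, j))))%:C%C = total G.
  rewrite (@total_sum _ _ s (fun i j => u i * F (i, j)) (fun i => normc (u i) * K)).
    by apply: eq_bigr => i _; rewrite (totalZ _ (l1_bound_row i FK)); case: (hu i).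
  by move=> i; apply: l1_boundZ; exact: l1_bound_row.
exact: normc_total.
Qed.

Lemma total_pair_finite F s : uniq s -> (forall p, p \notin s -> F p = 0) ->
  total (fun i => total (fun j => F (i, j))) = \sum_(p <- s) F p.
Proof.
move=> us F0; pose s1 := undup (map fst s); pose s2 := undup (map snd s).
have s1u : uniq s1 by exact: undup_uniq.
have s2u : uniq s2 by exact: undup_uniq.
have E i : total (fun j => F (i, j)) = \sum_(j <- s2) F (i, j).
  apply: total_support => // j; rewrite mem_undup => js; apply: F0.
  by apply: contra js => /(map_f snd).
rewrite (@total_support _ _ s1) //; last first.
  move=> i; rewrite mem_undup => js; apply: total0 => j; apply: F0.
  by apply: contra js => /(map_f fst).
under eq_bigr do rewrite E.
rewrite -big_allpairs.
rewrite (@big_uniq_sub _ _ s) //.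
- by rewrite [X in _ + X]big1 ?addr0 // => p /F0.
- by apply: allpairs_uniq => // -[a b] [a' b'] _ _ [-> ->].
move=> [a b] ps; apply/allpairsP; exists (a, b).
by rewrite !mem_undup (map_f fst ps) (map_f snd ps).
Qed.
End TwoFamilies.

(** Both sides agree exactly on a finite part of [F]. The remaining tail has norm at most [e / 2]
    and enters once in the iterated total and once in the joint one. *)
Lemma total_pair (T1 T2 : eqType) (F : T1 * T2 -> C) K : l1_bound F K ->
  total (fun i => total (fun j => F (i, j))) = total F.
Proof.
move=> FK; apply/eqP; rewrite -subr_eq0; apply/eqP.
apply: normc_eq0_small => e e0; have e2 : 0 < e / 2 by rewrite divr_gt0.
have [s us tl] := l1_bound_tail FK e2.
pose A p := if p \in s then F p else 0; pose B p := if p \in s then 0 else F p.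
have AK : l1_bound A K.
  by apply: l1_bound_le FK _ _ => // t; rewrite /A; case: ifP; rewrite ?normc0 ?normc_ge0.
have FE : F = (fun p => A p + B p).
  by apply: funext => p; rewrite /A /B; case: ifP; rewrite ?addr0 ?add0r.
have A0 p : p \notin s -> A p = 0 by rewrite /A => /negPf ->.
have -> : total (fun i => total (fun j => F (i, j))) =
   total (fun i => total (fun j => A (i, j))) + total (fun i => total (fun j => B (i, j))).
  rewrite -(totalD (l1_bound_marginal AK) (l1_bound_marginal tl)).
  congr total; apply: funext => i.
  rewrite -(totalD (l1_bound_row i AK) (l1_bound_row i tl)).
  by congr total; apply: funext => j; rewrite {1}FE.
have -> : total F = total A + total B by rewrite -(totalD AK tl) -FE.
rewrite (total_pair_finite us A0) (total_support us A0) [X in X - _]addrC addrKA (splitr e).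
apply: le_trans (normcB _ _) _; apply: lerD; last exact: normc_total tl.
exact: normc_total (l1_bound_marginal tl).
Qed.

Lemma total_swap (T1 T2 : eqType) (F : T1 * T2 -> C) K : l1_bound F K ->
  total (fun p => F (p.2, p.1)) = total F.
Proof.
move=> FK; apply: has_sum_total => e e0; have [s us hs] := has_sum_l1 FK e0.
have sw (U V : eqType) (r : seq (U * V)) : uniq r -> uniq (map (fun p => (p.2, p.1)) r).
  by move=> ur; rewrite map_inj_uniq // => -[a b] [a' b'] [-> ->].
exists (map (fun p => (p.2, p.1)) s) => [|r ur sub]; first exact: sw.
have := hs _ (sw _ _ _ ur); rewrite big_map; apply=> -[a b] ps.
by apply/mapP; exists (b, a) => //; apply: sub; apply/mapP; exists (a, b).
Qed.

Lemma total_exchange (T1 T2 : eqType) (F : T1 -> T2 -> C) K :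
  l1_bound (fun p : T1 * T2 => F p.1 p.2) K ->
  total (fun i => total (F i)) = total (fun j => total (fun i => F i j)).
Proof.
move=> FK; rewrite (total_pair FK) -(total_swap FK).
by rewrite -(total_pair (l1_bound_swap FK)).
Qed.
End Sums.


(** * Reindexing along injections *)

Section Reindex.
Variable R : realType.
Variables (T1 T2 : eqType) (phi : T2 -> T1) (f : T1 -> R[i]).
Hypothesis phi_inj : injective phi.

Lemma l1_bound_inj K : l1_bound f K -> l1_bound (f \o phi) K.
Proof.
move=> fK s us; apply: le_trans (fK (map phi s) _); first by rewrite big_map.
by rewrite map_inj_uniq.
Qed.

(** Fubini for the family carried by the graph of [phi]: every row, and by injectivity every column,
    has at most one nonzero entry. *)
Lemma total_inj K : l1_bound f K -> (forall t, f t <> 0 -> exists u, t = phi u) ->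
  total (f \o phi) = total f.
Proof.
move=> fK im; pose F u t := if t == phi u then f t else 0.
have -> : f \o phi = (fun u => total (F u)).
  apply: funext => u /=; rewrite (@total_support1 _ _ (F u) (phi u)) /F ?eqxx //.
  by move=> t /negPf ->.
rewrite (@total_exchange _ _ _ F K); last first.
  apply: (@l1_bound_pair _ _ _ _ (fun u => normc (f (phi u)))); last exact: l1_bound_inj.
  move=> u; rewrite -[normc (f _)]/(normc (f (phi u))).
  have := @l1_bound_support1 _ _ (F u) (phi u); rewrite /F eqxx; apply.
  by move=> t /negPf ->.
congr total; apply: funext => t; have [ft|/eqP/im[u tu]] := eqVneq (f t) 0.
  by rewrite total0 // => u; rewrite /F ft if_same.
rewrite (@total_support1 _ _ _ u) /F tu ?eqxx // => v vu.
by case: eqP => // /phi_inj uv; rewrite uv eqxx in vu.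
Qed.
End Reindex.

(** Finite functions have decidable equality, which unordered sums ask of their index type; they
    coerce to the plain functions [I -> nat] of the statement. *)
Definition mindex (I : finType) := {ffun I -> nat}.

(** * Evaluation and multiplication of power series on the closed unit polydisc *)

Section MultiIndex.
Variables (R : realType) (I : finType).
Local Notation C := R[i].
Implicit Types (z w : I -> C) (a b : mindex I).

Definition in_unit z := forall i, normc (z i) <= 1.

Definition addm a b : mindex I := [ffun i => a i + b i]%N.
Definition unitm (i : I) : mindex I := [ffun j => (j == i) : nat].
Definition zerom : mindex I := [ffun _ => 0%N].

Lemma multi_powD z a b : multi_pow z (addm a b) = multi_pow z a * multi_pow z b.
Proof. by rewrite -big_split; apply: eq_bigr => i _; rewrite ffunE exprD. Qed.

Lemma multi_pow0 z : multi_pow z zerom = 1.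
Proof. by apply: big1 => i _; rewrite ffunE expr0. Qed.

Lemma multi_pow_unit z i : multi_pow z (unitm i) = z i.
Proof.
rewrite /multi_pow (bigD1 i) //= big1 => [|j /negPf ji]; last by rewrite ffunE ji.
by rewrite ffunE eqxx mulr1.
Qed.

Lemma multi_powM z w (a : I -> nat) :
  multi_pow (fun i => z i * w i) a = multi_pow z a * multi_pow w a.
Proof. by rewrite -big_split; apply: eq_bigr => i _; rewrite exprMn. Qed.

Lemma normc_multi_pow z (a : I -> nat) :
  normc (multi_pow z a) = \prod_i normc (z i) ^+ a i.
Proof.
rewrite /multi_pow (big_morph _ (@normcM R) (@normc1 R)).
by apply: eq_bigr => i _; exact: normcX.
Qed.

Lemma normc_multi_pow_le1 z (a : I -> nat) : in_unit z -> normc (multi_pow z a) <= 1.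
Proof.
move=> z1; rewrite normc_multi_pow; apply: prodr_ile1 => i.
by rewrite exprn_ge0 ?normc_ge0 // exprn_ile1 ?normc_ge0.
Qed.

Definition ev (c : mindex I -> C) z : C := total (fun a => c a * multi_pow z a).

Lemma l1_bound_ev c z K : in_unit z -> l1_bound c K ->
  l1_bound (fun a => c a * multi_pow z a) K.
Proof.
move=> z1 cK; apply: l1_bound_le cK _ _ => // a.
by rewrite normcM ler_piMr ?normc_ge0 ?normc_multi_pow_le1.
Qed.

Lemma normc_ev c z K : in_unit z -> l1_bound c K -> normc (ev c z) <= K.
Proof. by move=> z1 cK; apply: normc_total; exact: l1_bound_ev. Qed.

Lemma evD c c' z K K' : in_unit z -> l1_bound c K -> l1_bound c' K' ->
  ev (fun a => c a + c' a) z = ev c z + ev c' z.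
Proof.
move=> z1 cK cK'; rewrite /ev -(totalD (l1_bound_ev z1 cK) (l1_bound_ev z1 cK')).
by congr total; apply: funext => a; rewrite mulrDl.
Qed.

Lemma evB c c' z K K' : in_unit z -> l1_bound c K -> l1_bound c' K' ->
  ev (fun a => c a - c' a) z = ev c z - ev c' z.
Proof.
move=> z1 cK cK'; rewrite /ev -(totalB (l1_bound_ev z1 cK) (l1_bound_ev z1 cK')).
by congr total; apply: funext => a; rewrite mulrBl.
Qed.

Lemma evZ (k : C) c z K : in_unit z -> l1_bound c K ->
  ev (fun a => k * c a) z = k * ev c z.
Proof.
move=> z1 cK; rewrite /ev -(totalZ _ (l1_bound_ev z1 cK)).
by congr total; apply: funext => a; rewrite mulrA.
Qed.

Lemma ev_sum (J : Type) (r : seq J) (c : J -> mindex I -> C) (K : J -> R) z :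
  in_unit z -> (forall j, l1_bound (c j) (K j)) ->
  ev (fun a => \sum_(j <- r) c j a) z = \sum_(j <- r) ev (c j) z.
Proof.
move=> z1 cK; rewrite /ev -(total_sum r (fun j => l1_bound_ev z1 (cK j))).
by congr total; apply: funext => a; rewrite mulr_suml.
Qed.

Lemma ev_0coef z : ev (fun=> 0) z = 0.
Proof. by apply: total0 => a; rewrite mul0r. Qed.

Lemma ev_support1 c a z : (forall b, b != a -> c b = 0) -> ev c z = c a * multi_pow z a.
Proof.
by move=> c0; rewrite /ev (@total_support1 _ _ _ a) // => b /c0 ->; rewrite mul0r.
Qed.

Lemma ev_at0 c : ev c zerov = c zerom.
Proof.
rewrite /ev (@total_support1 _ _ _ zerom) ?multi_pow0 ?mulr1 // => a a0.
have [i ai] : exists i, a i != 0%N.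
  apply/existsP; apply: contraNT a0; rewrite negb_exists => /forallP h.
  by apply/eqP/ffunP => i; rewrite ffunE; apply/eqP; move: (h i); rewrite negbK.
by rewrite /multi_pow (bigD1 i) //= /zerov expr0n (negPf ai) mul0r mulr0.
Qed.

Definition monom (k : C) a : mindex I -> C := fun b => if b == a then k else 0.

Lemma l1_bound_monom k a : l1_bound (monom k a) (normc k).
Proof.
have := @l1_bound_support1 _ _ (monom k a) a; rewrite /monom eqxx; apply.
by move=> b /negPf ->.
Qed.

Lemma ev_monom k a z : ev (monom k a) z = k * multi_pow z a.
Proof. by rewrite (@ev_support1 _ a) /monom ?eqxx // => b /negPf ->. Qed.

(** The Cauchy product, with an indicator in place of the finite set of decompositions of [d]: norm
    and value then follow by Fubini from the family [x p.1 * y p.2] of all pairs. *)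
Definition mulps (x y : mindex I -> C) : mindex I -> C := fun d =>
  total (fun p : mindex I * mindex I => if d == addm p.1 p.2 then x p.1 * y p.2 else 0).

Section Product.
Variables (x y : mindex I -> C) (A B : R).
Hypotheses (xA : l1_bound x A) (yB : l1_bound y B).

Lemma l1_bound_tensor : l1_bound (fun p => x p.1 * y p.2) (A * B).
Proof.
apply: (@l1_bound_pair _ _ _ _ (fun a => normc (x a) * B)) => [a|s us].
  exact: (l1_boundZ (x a) yB).
by rewrite -mulr_suml ler_wpM2r ?xA // (l1_bound_ge0 yB).
Qed.

Let F (p : mindex I * mindex I) d : C := if d == addm p.1 p.2 then x p.1 * y p.2 else 0.

Let l1_bound_F : l1_bound (fun u => F u.1 u.2) (A * B).
Proof.
apply: (@l1_bound_pair _ _ _ _ (fun p => normc (x p.1 * y p.2))) => [p|]; last first.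
  exact: l1_bound_tensor.
have := @l1_bound_support1 _ _ (F p) (addm p.1 p.2); rewrite /F eqxx; apply.
by move=> t /negPf ->.
Qed.

Lemma l1_bound_mulps : l1_bound (mulps x y) (A * B).
Proof. exact: l1_bound_marginal (l1_bound_swap l1_bound_F). Qed.

Lemma l1_bound_mulps_kernel d :
  l1_bound (fun p => if d == addm p.1 p.2 then x p.1 * y p.2 else 0) (A * B).
Proof.
apply: l1_bound_le l1_bound_tensor _ _ => // p; case: ifP => // _.
by rewrite normc0 normc_ge0.
Qed.

Lemma ev_mulps z : in_unit z -> ev (mulps x y) z = ev x z * ev y z.
Proof.
move=> z1.
have -> : ev (mulps x y) z = total (fun d => total (fun p => F p d * multi_pow z d)).
  congr total; apply: funext => d; rewrite mulrC.
  rewrite -(totalZ _ (l1_bound_mulps_kernel d)).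
  by congr total; apply: funext => p; rewrite mulrC.
(* With the pair of exponents outside, only [d = addm p.1 p.2] survives in the inner sum, and the
   sum over pairs factors. *)
rewrite -(@total_exchange _ _ _ (fun p d => F p d * multi_pow z d) (A * B)); last first.
  apply: l1_bound_le l1_bound_F _ _ => // u.
  by rewrite normcM ler_piMr ?normc_ge0 ?normc_multi_pow_le1.
pose G p := (x p.1 * multi_pow z p.1) * (y p.2 * multi_pow z p.2).
have -> : (fun p => total (fun d => F p d * multi_pow z d)) = G.
  apply: funext => p; rewrite (@total_support1 _ _ _ (addm p.1 p.2)).
    by rewrite /F eqxx multi_powD mulrACA.
  by move=> d /negPf dp; rewrite /F dp mul0r.
have GK : l1_bound G (A * B).
  apply: l1_bound_le l1_bound_tensor _ _ => // p.
  rewrite /G mulrACA -multi_powD normcM ler_piMr ?normc_ge0 //.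
  exact: normc_multi_pow_le1.
rewrite -(total_pair GK) /G /= [RHS]mulrC -(totalZ _ (l1_bound_ev z1 xA)).
congr total; apply: funext => a; rewrite [RHS]mulrC.
by rewrite -(totalZ _ (l1_bound_ev z1 yB)).
Qed.
End Product.

(** From [x y - x' y' = (x - x') y + x' (y - y')]. *)
Lemma l1_bound_mulpsB x x' y y' A A' B B' (e e' : R) :
  l1_bound x A -> l1_bound x' A' -> l1_bound y B -> l1_bound y' B' ->
  l1_bound (fun a => x a - x' a) e -> l1_bound (fun a => y a - y' a) e' ->
  l1_bound (fun a => mulps x y a - mulps x' y' a) (e * B + A' * e').
Proof.
move=> xA xA' yB yB' xe ye.
apply: l1_bound_le (l1_boundD (l1_bound_mulps xe yB) (l1_bound_mulps xA' ye)) _ _ => //.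
move=> d; rewrite /mulps.
rewrite -(totalD (l1_bound_mulps_kernel xe yB d) (l1_bound_mulps_kernel xA' ye d)).
rewrite -(totalB (l1_bound_mulps_kernel xA yB d) (l1_bound_mulps_kernel xA' yB' d)).
set u := total _; set v := total _; suff -> : u = v by [].
congr total; apply: funext => p /=; case: ifP => _; last by rewrite subr0 addr0.
ring.
Qed.
End MultiIndex.

(** * Identity theorem for power series *)

Section IdentityTheorem.
Variables (R : realType) (I : finType).
Local Notation C := R[i].
Implicit Types (z w : I -> C) (a b : mindex I) (c : mindex I -> C).

Definition upd z (i : I) (h : C) : I -> C := fun j => if j == i then h else z j.

Lemma addm_inj (i : I) : injective (addm (unitm i)).
Proof.
move=> a b /ffunP ab; apply/ffunP => j; move: (ab j); rewrite !ffunE.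
by move/addnI.
Qed.

Lemma mindexS i a : a i != 0%N -> exists b, a = addm (unitm i) b.
Proof.
move=> ai; exists [ffun j => (a j - (j == i))%N]; apply/ffunP => j.
rewrite !ffunE; case: eqP => [->|_]; last by rewrite subn0.
by rewrite subnKC // lt0n.
Qed.

Lemma multi_pow_upd0 z i h a : a i = 0%N -> multi_pow (upd z i h) a = multi_pow (upd z i 0) a.
Proof.
move=> ai; apply: eq_bigr => j _; rewrite /upd; case: eqP => // ->.
by rewrite ai.
Qed.

Lemma in_unit_upd z i h : in_unit z -> normc h <= 1 -> in_unit (upd z i h).
Proof. by move=> z1 h1 j; rewrite /upd; case: eqP. Qed.

(** The exponents with [a i = 0] sum to the value at [z_i = 0]; the others are exactly the image of
    the shift by [unitm i]. *)
Lemma ev_upd c K z i h : l1_bound c K -> in_unit z -> normc h <= 1 ->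
  ev c (upd z i h) = ev c (upd z i 0) + h * ev (c \o addm (unitm i)) (upd z i h).
Proof.
move=> cK z1 h1; have w1 := in_unit_upd i z1 h1.
have w0 : in_unit (upd z i 0) by apply: in_unit_upd => //; rewrite normc0.
pose f a := if a i == 0%N then 0 else c a * multi_pow (upd z i h) a.
have fK : l1_bound f K.
  apply: l1_bound_le (l1_bound_ev w1 cK) _ _ => // a.
  by rewrite /f; case: ifP; rewrite ?normc0 ?normc_ge0.
have -> : h * ev (c \o addm (unitm i)) (upd z i h) = total f.
  rewrite -(total_inj (@addm_inj i) fK); last first.
    by move=> a; rewrite /f; have [//|/mindexS] := eqVneq (a i) 0%N.
  rewrite /ev -(totalZ _ (l1_bound_ev w1 (l1_bound_inj (@addm_inj i) cK))).
  congr total; apply: funext => a /=; rewrite /f !ffunE eqxx /=.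
  by rewrite multi_powD multi_pow_unit /upd eqxx mulrCA.
rewrite /ev -(totalD (l1_bound_ev w0 cK) fK); congr total; apply: funext => a.
rewrite /f; case: eqP => [ai|/eqP ai]; first by rewrite (multi_pow_upd0 _ _ ai) addr0.
have -> : multi_pow (upd z i 0) a = 0.
  by rewrite /multi_pow (bigD1 i) //= /upd eqxx expr0n (negPf ai) mul0r.
by rewrite mulr0 add0r.
Qed.

(* Writing [c = c_(z_i = 0) + z_i c'] shows that the series [c'] vanishes where [z_i <> 0];
   the same decomposition of [c'] extends this to [z_i = 0]. *)
Lemma ev_shift_eq0 c K i : l1_bound c K -> (forall z, in_unit z -> ev c z = 0) ->
  forall z, in_unit z -> ev (c \o addm (unitm i)) z = 0.
Proof.
move=> cK c0; pose g := c \o addm (unitm i).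
have gK : l1_bound g K by apply: l1_bound_inj => //; exact: addm_inj.
have updE z : upd z i (z i) = z.
  by apply: funext => j; rewrite /upd; case: eqP => // ->.
have nz z : in_unit z -> z i != 0 -> ev g z = 0.
  move=> z1 zi; have := ev_upd i cK z1 (z1 i); rewrite updE !c0 //; last first.
    by apply: in_unit_upd => //; rewrite normc0.
  by rewrite add0r => /esym/eqP; rewrite mulf_eq0 (negPf zi) => /eqP.
move=> z z1; have [zi|] := eqVneq (z i) 0; last exact: nz.
(* Here [h <= 1] keeps the modified point in the polydisc, and [h * K <= e] bounds the difference
   between the values of [g] at [z_i = 0] and at [z_i = h], the latter being zero. *)
apply: normc_eq0_small => e e0; pose h : R := e / (e + K).
have K0 := l1_bound_ge0 gK.
have eK : 0 < e + K by lra.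
have h0 : 0 < h by rewrite divr_gt0.
have h1 : normc h%:C%C <= 1 by rewrite (normc_real_ge0 (ltW h0)) /h ler_pdivrMr // mul1r lerDl.
have w1 := in_unit_upd i z1 h1.
have := ev_upd i gK z1 h1; rewrite nz //; last first.
  by rewrite /upd eqxx; apply/eqP => -[] he; rewrite he ltxx in h0.
rewrite -[X in upd z i X]zi updE => /esym/eqP; rewrite addr_eq0 => /eqP ->.
rewrite normcN normcM (normc_real_ge0 (ltW h0)).
apply: le_trans (ler_wpM2l (ltW h0) (normc_ev w1 (l1_bound_inj (@addm_inj i) gK))) _.
by rewrite /h mulrAC ler_pdivrMr // ler_pM2l // lerDr ltW.
Qed.

(** Induction on a bound for the total degree: the constant coefficient is the value at the origin,
    and any other one is a coefficient of lower degree in a shifted series, which again vanishes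
    identically. *)
Lemma ev_eq0 c K : l1_bound c K -> (forall z, in_unit z -> ev c z = 0) ->
  forall a, c a = 0.
Proof.
move=> cK c0 a; move: {-1}(\sum_i a i)%N (leqnn (\sum_i a i)) => k.
elim: k c cK c0 a => [|k IH] c cK c0 a.
  rewrite leqn0 sum_nat_eq0 => /forallP a0.
  have -> : a = zerom I by apply/ffunP => i; rewrite ffunE; apply/eqP; exact: a0.
  by rewrite -ev_at0 c0 // => i; rewrite /zerov normc0.
move=> ak; have [/existsP[i ai]|] := boolP [exists i, a i != 0%N]; last first.
  rewrite negb_exists => /forallP h; apply: IH cK c0 _ _.
  by rewrite big1 // => i _; apply/eqP; move: (h i); rewrite negbK.
have [b ab] := mindexS ai; rewrite ab.
apply: (IH (c \o addm (unitm i)) (l1_bound_inj (@addm_inj i) cK)).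
  exact: ev_shift_eq0 cK c0.
move: ak; rewrite ab; under eq_bigr do rewrite !ffunE.
rewrite big_split /= (bigD1 i) //= eqxx big1 ?addn0 // => j /negPf -> //.
Qed.

Lemma ev_inj c c' K K' : l1_bound c K -> l1_bound c' K' ->
  (forall z, in_unit z -> ev c z = ev c' z) -> forall a, c a = c' a.
Proof.
move=> cK cK' e a; apply/eqP; rewrite -subr_eq0; apply/eqP.
apply: (ev_eq0 (l1_boundB cK cK')) => z z1.
by rewrite (evB z1 cK cK') e // subrr.
Qed.
End IdentityTheorem.

(** * Substitution of series of norm at most one *)

Section Composition.
Variables (R : realType) (J I : finType).
Local Notation C := R[i].
Implicit Types (x : J -> mindex I -> C) (c : mindex J -> C) (l : seq J) (M d : J -> R).

(** The variables of a monomial listed with multiplicity: products of series, and the telescoping of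
    their differences, become recursions on a list. *)
Definition factors (g : mindex J) : seq J := flatten [seq nseq (g i) i | i <- enum J].

Lemma count_factors g i : count_mem i (factors g) = g i.
Proof.
rewrite /factors count_flatten -map_comp sumnE big_map big_enum /= (bigD1 i) //=.
rewrite count_nseq /= eqxx mul1n big1 ?addn0 // => j /negPf ji.
by rewrite count_nseq /= ji.
Qed.

Lemma prod_factors (v : J -> C) g : \prod_(i <- factors g) v i = multi_pow v g.
Proof.
rewrite /factors big_flatten big_map big_enum; apply: eq_bigr => i _.
by rewrite big_nseq iter_mulr_1.
Qed.

Definition prodps x l : mindex I -> C := foldr (fun i y => mulps (x i) y) (monom 1 (zerom I)) l.

Definition compps c x : mindex I -> C :=
  fun a => total (fun g => c g * prodps x (factors g) a).

(* Telescoping bound for [prod x - prod x'] when the factors are bounded by [M] and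
   differ by at most [d]. *)
Fixpoint prod_diff M d l : R :=
  if l is i :: l' then d i * \prod_(j <- l') M j + M i * prod_diff M d l' else 0.

Lemma l1_bound_prodps x M l : (forall i, l1_bound (x i) (M i)) ->
  l1_bound (prodps x l) (\prod_(j <- l) M j).
Proof.
move=> xM; elim: l => [|i l IH]; last by rewrite big_cons; exact: l1_bound_mulps.
by rewrite big_nil -(@normc1 R); exact: l1_bound_monom.
Qed.

Lemma l1_bound_prodps1 x l : (forall i, l1_bound (x i) 1) -> l1_bound (prodps x l) 1.
Proof. by move=> x1; have := l1_bound_prodps l x1; rewrite big1. Qed.

Lemma ev_prodps x M l z : (forall i, l1_bound (x i) (M i)) -> in_unit z ->
  ev (prodps x l) z = \prod_(i <- l) ev (x i) z.
Proof.
move=> xM z1; elim: l => [|i l IH].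
  by rewrite big_nil /= ev_monom multi_pow0 mulr1.
by rewrite big_cons /= (ev_mulps (xM i) (l1_bound_prodps l xM)) // IH.
Qed.

Lemma l1_bound_prodpsB x x' M d l :
  (forall i, l1_bound (x i) (M i)) -> (forall i, l1_bound (x' i) (M i)) ->
  (forall i, l1_bound (fun a => x i a - x' i a) (d i)) ->
  l1_bound (fun a => prodps x l a - prodps x' l a) (prod_diff M d l).
Proof.
move=> xM xM' xd; elim: l => [|i l IH] /=.
  by apply: l1_bound_le (@l1_bound0 R _) _ _ => // t; rewrite subrr.
apply: l1_bound_mulpsB (xM i) (xM' i) _ _ (xd i) IH; exact: l1_bound_prodps.
Qed.

Section Bounded.
Variables (c : mindex J -> C) (K : R).
Hypothesis cK : l1_bound c K.

Let kernel_bound x : (forall i, l1_bound (x i) 1) ->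
  l1_bound (fun p => c p.1 * prodps x (factors p.1) p.2) K.
Proof.
move=> x1; apply: (@l1_bound_pair _ _ _ _ (fun g => normc (c g))) => // g.
have := l1_boundZ (c g) (l1_bound_prodps1 (factors g) x1).
by rewrite mulr1.
Qed.

Lemma l1_bound_compps x : (forall i, l1_bound (x i) 1) -> l1_bound (compps c x) K.
Proof. by move=> x1; exact: l1_bound_marginal (l1_bound_swap (kernel_bound x1)). Qed.

Lemma in_unit_ev x z : (forall i, l1_bound (x i) 1) -> in_unit z ->
  in_unit (fun i => ev (x i) z).
Proof. by move=> x1 z1 i; exact: normc_ev. Qed.

(** Fubini for the double family over outer exponents [g] and inner exponents [a]. Products of
    series of norm at most one have norm at most one, so row [g] has norm at most [normc (c g)]. *)
Lemma ev_compps x z : (forall i, l1_bound (x i) 1) -> in_unit z ->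
  ev (compps c x) z = ev c (fun i => ev (x i) z).
Proof.
move=> x1 z1; have kb := kernel_bound x1.
have -> : ev (compps c x) z
  = total (fun a => total (fun g => c g * prodps x (factors g) a * multi_pow z a)).
  congr total; apply: funext => a; rewrite mulrC /compps.
  rewrite -(totalZ _ (l1_bound_row a (l1_bound_swap kb))).
  by congr total; apply: funext => g; rewrite mulrC.
rewrite -(@total_exchange _ _ _ (fun g a => c g * prodps x (factors g) a * multi_pow z a) K).
  congr total; apply: funext => g.
  rewrite -(prod_factors (fun i => ev (x i) z)) -(ev_prodps _ x1 z1).
  rewrite -(totalZ _ (l1_bound_ev z1 (l1_bound_prodps1 (factors g) x1))).
  by congr total; apply: funext => a; rewrite mulrA.
apply: l1_bound_le kb _ _ => // p.
by rewrite normcM ler_piMr ?normc_ge0 ?normc_multi_pow_le1.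
Qed.

(** Reduces every Lipschitz estimate for substitution to a bound [k g] for one monomial at a time,
    weighted by the outer coefficients. *)
Lemma l1_bound_comppsB x x' (k : mindex J -> R) e :
  (forall i, l1_bound (x i) 1) -> (forall i, l1_bound (x' i) 1) ->
  (forall g, l1_bound (fun a => prodps x (factors g) a - prodps x' (factors g) a) (k g)) ->
  sum_bound (fun g => normc (c g) * k g) e ->
  l1_bound (fun a => compps c x a - compps c x' a) e.
Proof.
move=> x1 x1' xk ke.
have -> : (fun a => compps c x a - compps c x' a) =
    (fun a => total (fun g => c g * (prodps x (factors g) a - prodps x' (factors g) a))).
  apply: funext => a; rewrite /compps.
  rewrite -(totalB (l1_bound_row a (l1_bound_swap (kernel_bound x1)))
                   (l1_bound_row a (l1_bound_swap (kernel_bound x1')))).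
  by congr total; apply: funext => g; rewrite mulrBr.
pose F p := c p.1 * (prodps x (factors p.1) p.2 - prodps x' (factors p.1) p.2).
have Fe : l1_bound F e by apply: l1_bound_pair ke => g; exact: (l1_boundZ (c g) (xk g)).
exact: l1_bound_marginal (l1_bound_swap Fe).
Qed.
End Bounded.
End Composition.


(** * Common radii and bounds for finitely many conditions *)

Lemma finite_common_radius (R : realType) (I : finType) (P : I -> R -> Prop) :
  (forall i, exists2 r, 0 < r & forall r', 0 < r' <= r -> P i r') ->
  exists2 r, 0 < r & forall r', 0 < r' <= r -> forall i, P i r'.
Proof.
move=> h.
suff [r r0 hr] : exists2 r, 0 < r &
    forall r', 0 < r' <= r -> forall i, i \in enum I -> P i r'.
  by exists r => // r' rr' i; apply: hr => //; rewrite mem_enum.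
elim: (enum I) => [|i s [r r0 hr]]; first by exists 1.
have [ri ri0 hi] := h i; exists (Num.min ri r); first by rewrite lt_min ri0.
move=> r' /andP[r'0]; rewrite le_min => /andP[l1 l2] j; rewrite inE.
by case/predU1P => [->|js]; [apply: hi|apply: hr]; rewrite ?r'0.
Qed.

Lemma finite_common_bound (R : realType) (I : finType) (P : I -> R -> Prop) :
  (forall i K K', P i K -> K <= K' -> P i K') -> (forall i, exists K, P i K) ->
  exists2 K, 0 < K & forall i, P i K.
Proof.
move=> mono /choice[k hk]; exists (1 + \sum_i `|k i|).
  by rewrite ltr_wpDr ?sumr_ge0.
move=> i; apply: mono (hk i) _; rewrite (bigD1 i) //=.
have := ler_norm (k i); have : 0 <= \sum_(j | j != i) `|k j| by exact: sumr_ge0.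
lra.
Qed.

(** * Contraction principle for tuples of summable families *)

Section FixedPoint.
Variable R : realType.
Local Notation C := R[i].

(** Any finite set of indices lies in an initial segment, over which the sum telescopes because
    [r * 2^-1 ^+ k.+1] is also the drop from [r * 2^-1 ^+ k] to the next power. *)
Lemma sum_bound_geometric (r : R) N : 0 <= r ->
  sum_bound (fun k => if (k < N)%N then 0 else r * 2^-1 ^+ k.+1) (r * 2^-1 ^+ N).
Proof.
move=> r0; set g := (X in sum_bound X _) => s us.
have g0 k : 0 <= g k by rewrite /g; case: ifP => // _; rewrite mulr_ge0 ?exprn_ge0 ?invr_ge0.
pose B := (\max_(k <- s) k).+1; pose t := iota 0 (N + B).
have sub : {subset s <= t}.
  move=> k ks; rewrite mem_iota add0n /= ltn_addl // ltnS.
  by rewrite (big_rem k) //= leq_maxl.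
apply: (@le_trans _ _ (\sum_(k <- t) g k)).
  by rewrite [leRHS](big_uniq_sub _ us (iota_uniq _ _) sub) lerDl sumr_ge0.
suff -> : \sum_(k <- t) g k = r * 2^-1 ^+ N - r * 2^-1 ^+ (N + B).
  by rewrite lerBlDr lerDl mulr_ge0 ?exprn_ge0 ?invr_ge0.
rewrite /t -[X in iota _ X]subn0 -/(index_iota 0 (N + B)); elim: B {t sub} => [|B IH].
  rewrite addn0 subrr big_nat big1 // => k /andP[_ kN]; by rewrite /g kN.
rewrite addnS big_nat_recr //= IH /g ltnNge leq_addr /= exprS.
lra.
Qed.

Variables (n : nat) (T : eqType) (Phi : ('I_n -> T -> C) -> 'I_n -> T -> C) (r : R).
Hypothesis r0 : 0 < r.
Hypothesis contr : forall y y' e,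
  (forall j, l1_bound (y j) r) -> (forall j, l1_bound (y' j) r) ->
  (forall j, l1_bound (fun t => y j t - y' j t) e) ->
  forall j, l1_bound (fun t => Phi y j t - Phi y' j t) (e / 2).
Hypothesis Phi0 : forall j, l1_bound (Phi (fun _ _ => 0) j) (r / 2).

Let Y k := iter k Phi (fun _ _ => 0).
Let D k j t := Y k.+1 j t - Y k j t.

(** The radius in the invariant is sharp: adding the increment bound [r * 2^-1 ^+ k.+1] gives
    exactly the next radius, so the iterates never leave the ball on which [contr] applies. *)
Let iterate_bound k : (forall j, l1_bound (Y k j) (r - r * 2^-1 ^+ k)) /\
  (forall j, l1_bound (D k j) (r * 2^-1 ^+ k.+1)).
Proof.
have le_r k' K : K = r - r * 2^-1 ^+ k' -> K <= r.
  by move=> ->; rewrite lerBlDr lerDl mulr_ge0 ?exprn_ge0 ?invr_ge0 ?ltW.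
elim: k => [|k [IHY IHD]].
  split=> j; first by rewrite expr0 mulr1 subrr; exact: l1_bound0.
  rewrite expr1; apply: l1_bound_le (Phi0 j) _ _ => // t.
  by rewrite /D /= subr0.
have Y1 j : l1_bound (Y k.+1 j) (r - r * 2^-1 ^+ k.+1).
  apply: l1_bound_le (l1_boundD (IHY j) (IHD j)) _ _.
    by move=> t; rewrite /D addrC subrK.
  by rewrite exprS; lra.
split=> // j; rewrite exprS mulrCA mulrC.
apply: contr => // i; [exact: l1_boundW (Y1 i) (le_r k.+1 _ erefl)|].
exact: l1_boundW (IHY i) (le_r k _ erefl).
Qed.

(** The limit of the iterates as the sum of their increments; summability of the double family [D]
    takes the place of a completeness argument. *)
Let y j t := total (fun k => D k j t).

Let D_pair j : l1_bound (fun p : nat * T => D p.1 j p.2) r.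
Proof.
have := sum_bound_geometric 0 (ltW r0); rewrite expr0 mulr1; apply: l1_bound_pair.
by move=> k; exact: (proj2 (iterate_bound k)).
Qed.

Let tail_bound N j : l1_bound (fun t => y j t - Y N j t) (r * 2^-1 ^+ N).
Proof.
pose E k t := if (k < N)%N then 0 else D k j t.
have Eb : l1_bound (fun p : nat * T => E p.1 p.2) (r * 2^-1 ^+ N).
  apply: l1_bound_pair (sum_bound_geometric N (ltW r0)) => k.
  rewrite /E /=; case: ifP => _; first exact: l1_bound0.
  exact: (proj2 (iterate_bound k)).
suff -> : (fun t => y j t - Y N j t) = (fun t => total (fun k => E k t)).
  exact: l1_bound_marginal (l1_bound_swap Eb).
apply: funext => t; pose F k := if (k < N)%N then D k j t else 0.
have Dr := l1_bound_row t (l1_bound_swap (D_pair j)).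
have Fr : l1_bound F r.
  by apply: l1_bound_le Dr _ _ => // k; rewrite /F /=; case: ifP => // _; rewrite normc0 normc_ge0.
have -> : Y N j t = total F.
  rewrite (@total_support _ _ _ (iota 0 N)) ?iota_uniq //; last first.
    by move=> k; rewrite mem_iota /= add0n /F => /negPf ->.
  rewrite -[X in iota _ X]subn0 -/(index_iota 0 N).
  rewrite (eq_big_nat _ _ (F2 := fun k => Y k.+1 j t - Y k j t)).
    by rewrite telescope_sumr // subr0.
  by move=> k /andP[_ kN]; rewrite /F kN.
rewrite /y -(totalB Dr Fr); congr total; apply: funext => k.
by rewrite /F /E /=; case: ifP; rewrite ?subrr ?subr0.
Qed.

Lemma contraction_fixpoint :
  exists y, (forall j, l1_bound (y j) r) /\ forall j t, Phi y j t = y j t.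
Proof.
have yr j : l1_bound (y j) r.
  have := tail_bound 0 j; rewrite expr0 mulr1 => h.
  apply: l1_bound_le h _ _ => // t.
  by rewrite /= subr0.
exists y; split=> // j t; apply/eqP; rewrite -subr_eq0; apply/eqP; move: t.
apply: l1_bound_eq0 => e e0.
have [N hN] : exists N, r * 2^-1 ^+ N <= e.
  have [N] : exists N : nat, r / e < N%:R.
    by exists (Num.Def.archi_bound (r / e)); apply: archi_boundP; rewrite divr_ge0 ?ltW.
  rewrite ltr_pdivrMr // => h; exists N.
  have hk : (N%:R : R) <= 2 ^+ N by rewrite -natrX ler_nat ltnW // ltn_expl.
  rewrite exprVn ler_pdivrMr ?exprn_gt0 // mulrC; apply: le_trans (ltW h) _.
  by rewrite ler_pM2r.
have YN k i : l1_bound (Y k i) r.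
  apply: l1_boundW (proj1 (iterate_bound k) i) _.
  by rewrite lerBlDr lerDl mulr_ge0 ?exprn_ge0 ?invr_ge0 ?ltW.
(* [Phi y - y] is [(Phi y - Phi (Y N)) - (y - Y N.+1)], and each bracket has norm at most
   [r * 2^-1 ^+ N.+1]. *)
have h1 := contr yr (YN N) (tail_bound N) j.
apply: l1_bound_le (l1_boundB h1 (tail_bound N.+1 j)) _ _.
  move=> t; rewrite /= -/(Y N) [X in normc _ <= normc X](_ : _ = Phi y j t - y j t) //.
  ring.
by rewrite exprS; lra.
Qed.
End FixedPoint.

(** * Box sums and unordered sums *)

Section BoxSums.
Variables (R : realType) (I : finType).
Local Notation C := R[i].

Definition box N : seq (mindex I) :=
  [seq [ffun i => nat_of_ord (a i)] | a : {ffun I -> 'I_N}].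

Lemma box_uniq N : uniq (box N).
Proof.
rewrite map_inj_uniq ?enum_uniq // => a b /ffunP ab; apply/ffunP => i.
by apply: val_inj; have := ab i; rewrite !ffunE.
Qed.

Lemma mem_box N a : (a \in box N) = [forall i, (a i < N)%N].
Proof.
apply/mapP/forallP => [[b _ ->] i|h]; first by rewrite ffunE.
exists [ffun i => Ordinal (h i)]; first by rewrite mem_enum.
by apply/ffunP => i; rewrite !ffunE.
Qed.

Lemma sub_box (s : seq (mindex I)) : exists N0, forall N, (N0 <= N)%N -> {subset s <= box N}.
Proof.
exists (\max_(a <- s) \max_i (a i)).+1 => N hN a sa; rewrite mem_box.
apply/forallP => i; apply: leq_ltn_trans hN.
rewrite (big_rem a) //=; apply: leq_trans (leq_maxl _ _); exact: (leq_bigmax i).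
Qed.

Lemma big_box (V : nmodType) N (F : (I -> nat) -> V) :
  \sum_(a <- box N) F a = \sum_(a : {ffun I -> 'I_N}) F (fun i => nat_of_ord (a i)).
Proof.
rewrite /box /image_mem big_map big_enum /=; apply: eq_bigr => a _; congr F.
by apply: funext => i; rewrite ffunE.
Qed.

Definition terms (c : (I -> nat) -> C) (z : I -> C) : mindex I -> C :=
  fun a => c a * multi_pow z a.

Lemma box_sumE c z N : box_sum c z N = \sum_(a <- box N) terms c z a.
Proof. by rewrite (big_box _ (fun a => c a * multi_pow z a)). Qed.

Lemma abs_box_sumE c z N :
  abs_box_sum c z N = (\sum_(a <- box N) normc (terms c z a))%:C%C.
Proof.
rewrite (big_box _ (fun a => normc (c a * multi_pow z a))) rmorph_sum.
by apply: eq_bigr => a _; rewrite normcM rmorphM /= !normcE_real.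
Qed.

(** Every finite set of exponents lies in all large boxes: bounded box sums of moduli thus amount to
    absolute summability, and the limit over boxes is the unordered total. *)
Lemma ps_converges_toE c z l : ps_converges_to c z l <->
  (exists K, l1_bound (terms c z) K) /\ total (terms c z) = l.
Proof.
split=> [[[M hM] lim]|[[K fK] <-]].
  have fK : l1_bound (terms c z) (complex.Re M).
    move=> s us; have [N /(_ N (leqnn _)) sub] := sub_box s.
    have := hM N; rewrite abs_box_sumE lecE => /andP[_]; apply: le_trans.
    rewrite [leRHS](big_uniq_sub _ us (box_uniq N) sub) lerDl sumr_ge0 // => a _.
    exact: normc_ge0.
  split; first by exists (complex.Re M).
  apply/eqP; rewrite -subr_eq0; apply/eqP; apply: normc_eq0_small => e e0.
  have e2 : 0 < e / 2 by rewrite divr_gt0.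
  have [s us hs] := has_sum_l1 fK e2.
  have [N1 sub] := sub_box s; have [|N0 hN] := lim (e / 2)%:C%C; first by rewrite ltcR.
  have := hN (maxn N0 N1) (leq_maxl _ _); rewrite box_sumE normcE_real ltcR => h1.
  have := hs _ (box_uniq _) (sub _ (leq_maxr N0 N1)) => h2.
  move: h1 h2; set S := \sum_(_ <- _) _ => h1 h2.
  have -> : total (terms c z) - l = (S - l) - (S - total (terms c z)) by ring.
  by apply: le_trans (normcB _ _) _; rewrite (splitr e) lerD // ltW.
split; first by exists K%:C%C => N; rewrite abs_box_sumE lecR fK ?box_uniq.
move=> e /gt0_complexE[-> e0]; have e2 : 0 < complex.Re e / 2 by rewrite divr_gt0.
have [s us hs] := has_sum_l1 fK e2; have [N0 sub] := sub_box s.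
exists N0 => N hN; rewrite box_sumE normcE_real ltcR.
by apply: le_lt_trans (hs _ (box_uniq N) (sub _ hN)) _; lra.
Qed.

Lemma ps_converges_to_scaled (c : (I -> nat) -> C) (rho : R) z l :
  ps_converges_to c (fun i => rho%:C%C * z i) l ->
  ev (fun a : mindex I => c a * multi_pow (fun=> rho%:C%C) a) z = l.
Proof.
move/ps_converges_toE => [_ <-]; congr total; apply: funext => a.
by rewrite /terms multi_powM mulrA.
Qed.

(** Returns from normalized coordinates [w = lam z] to the original ones: the coefficients absorb
    [lam^a], and [k] rescales the values. *)
Lemma ev_ps_converges_to (c : mindex I -> C) K (k : C) (lam z w : I -> C) :
  l1_bound c K -> in_unit w -> (forall i, w i = lam i * z i) ->
  ps_converges_to (fun a => k * (c [ffun i => a i] * multi_pow lam a)) z (k * ev c w).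
Proof.
move=> cK w1 wE; apply/ps_converges_toE.
have -> : terms (fun a => k * (c [ffun i => a i] * multi_pow lam a)) z
    = (fun a => k * (c a * multi_pow w a)).
  apply: funext => a; rewrite /terms (_ : w = fun i => lam i * z i); last exact: funext.
  by rewrite multi_powM ffunK !mulrA.
split; first by exists (normc k * K); apply: l1_boundZ; exact: l1_bound_ev.
exact: totalZ (l1_bound_ev w1 cK).
Qed.

(** An exponent outside the box is at least [N] in some variable, so its monomial is at most
    [2^-1 ^+ N] on the half-size polydisc. This rate is the source of uniform convergence. *)
Lemma box_tail (c : mindex I -> C) K z N : l1_bound c K ->
  (forall i, normc (z i) <= 2^-1) ->
  normc (\sum_(a <- box N) c a * multi_pow z a - ev c z) <= K * 2^-1 ^+ N.
Proof.
move=> cK z2; have z1 : in_unit z by move=> i; apply: le_trans (z2 i) _; lra.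
pose A a := if a \in box N then c a * multi_pow z a else 0.
have AK : l1_bound A K.
  apply: l1_bound_le (l1_bound_ev z1 cK) _ _ => // a; rewrite /A.
  by case: ifP; rewrite ?normc0 ?normc_ge0.
have -> : \sum_(a <- box N) c a * multi_pow z a = total A.
  rewrite (@total_support _ _ _ (box N)) ?box_uniq // => [|a /negPf aN].
    by rewrite big_seq [RHS]big_seq; apply: eq_bigr => a; rewrite /A => ->.
  by rewrite /A aN.
rewrite -(totalB AK (l1_bound_ev z1 cK)); apply: normc_total.
have := l1_boundZ ((2^-1 : R) ^+ N)%:C%C cK; rewrite mulrC normc_real_ge0; last first.
  by rewrite exprn_ge0 ?invr_ge0.
have h0 : (0 : R) <= 2^-1 ^+ N by rewrite exprn_ge0 ?invr_ge0.
move=> h; apply: l1_bound_le h _ _ => // a; rewrite /A; case: ifPn => [_|].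
  by rewrite subrr normc0 normc_ge0.
rewrite mem_box => /forallPn[k]; rewrite -leqNgt => Nk.
rewrite sub0r normcN !normcM mulrC normc_real_ge0 // ler_wpM2r ?normc_ge0 //.
rewrite normc_multi_pow (bigD1 k) //=.
have h1 : \prod_(j | j != k) normc (z j) ^+ a j <= 1.
  by apply: prodr_ile1 => j _; rewrite exprn_ge0 ?normc_ge0 // exprn_ile1 ?normc_ge0.
have h2 : normc (z k) ^+ a k <= 2^-1 ^+ N.
  apply: (@le_trans _ _ (2^-1 ^+ a k)).
    by rewrite lerXn2r ?nnegrE ?normc_ge0 ?invr_ge0.
  by rewrite ler_wiXn2l ?invr_ge0 //; lra.
rewrite -[leRHS]mulr1; apply: ler_pM => //; first by rewrite exprn_ge0 ?normc_ge0.
by rewrite prodr_ge0 // => j _; rewrite exprn_ge0 ?normc_ge0.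
Qed.
End BoxSums.


(** * Uniform bounds for the resolvent matrices *)

Section Resolvent.
Variable R : realType.
Local Notation C := R[i].

Lemma exp_small (x e : R) : 0 <= x -> x < 1 -> 0 < e -> exists N, x ^+ N <= e.
Proof.
move=> x0 x1 e0.
(* A Bernoulli inequality; [N] is then taken so large that [1 <= e * (1 + N%:R * (1 - x))]. *)
have bern N : x ^+ N * (1 + N%:R * (1 - x)) <= 1.
  elim: N => [|N IH]; first by rewrite expr0 mul0r addr0 mulr1.
  apply: le_trans IH; rewrite exprSr -mulrA ler_wpM2l ?exprn_ge0 //.
  have : 0 <= N%:R * (1 - x) * (1 - x) by rewrite !mulr_ge0 // subr_ge0 ltW.
  rewrite -natr1; nra.
have d0 : 0 < e * (1 - x) by rewrite mulr_gt0 ?subr_gt0.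
pose N := Num.Def.archi_bound (e * (1 - x))^-1; exists N.
have hN : (e * (1 - x))^-1 < N%:R by apply: archi_boundP; rewrite invr_ge0 ltW.
have : 1 <= e * (1 + N%:R * (1 - x)).
  move: hN; rewrite -[X in X < _]mul1r ltr_pdivrMr // => hN; nra.
move=> h; have p0 : 0 < 1 + N%:R * (1 - x).
  by rewrite ltr_wpDr // mulr_ge0 // subr_ge0 ltW.
by rewrite -(ler_pM2r p0); apply: le_trans (bern N) h.
Qed.

(** This norm is submultiplicative and dominates each entry. *)
Definition mxnorm1 (n : nat) (A : 'M[C]_n) : R := \sum_i \sum_j normc (A i j).

Lemma mxnorm1_ge0 n (A : 'M[C]_n) : 0 <= mxnorm1 A.
Proof. by apply: sumr_ge0 => i _; apply: sumr_ge0 => j _; exact: normc_ge0. Qed.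

Lemma mxnorm1_entry n (A : 'M[C]_n) i j : normc (A i j) <= mxnorm1 A.
Proof.
rewrite /mxnorm1 (bigD1 i) //= (bigD1 j) //= -addrA lerDl addr_ge0 // ?sumr_ge0 // => k _.
  exact: normc_ge0.
by rewrite sumr_ge0 // => l _; exact: normc_ge0.
Qed.

Lemma mxnorm1B n (A B : 'M[C]_n) : mxnorm1 (A - B) <= mxnorm1 A + mxnorm1 B.
Proof.
rewrite /mxnorm1 -big_split; apply: ler_sum => i _; rewrite -big_split.
by apply: ler_sum => j _; rewrite !mxE; exact: normcB.
Qed.

Lemma mxnorm1Z n (c : C) (A : 'M[C]_n) : mxnorm1 (c *: A) = normc c * mxnorm1 A.
Proof.
rewrite /mxnorm1 mulr_sumr; apply: eq_bigr => i _; rewrite mulr_sumr.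
by apply: eq_bigr => j _; rewrite mxE normcM.
Qed.

Lemma mxnorm1M n (A B : 'M[C]_n) : mxnorm1 (A *m B) <= mxnorm1 A * mxnorm1 B.
Proof.
have h i : \sum_j normc ((A *m B) i j) <= \sum_k normc (A i k) * mxnorm1 B.
  apply: (@le_trans _ _ (\sum_j \sum_k normc (A i k) * normc (B k j))).
    apply: ler_sum => j _; rewrite mxE; apply: le_trans (normc_sum _ _) _.
    by apply: ler_sum => k _; rewrite normcM.
  rewrite exchange_big; apply: ler_sum => k _; rewrite -mulr_sumr.
  rewrite ler_wpM2l ?normc_ge0 // /mxnorm1 [leRHS](bigD1 k) //= lerDl sumr_ge0 // => i' _.
  by apply: sumr_ge0 => j _; exact: normc_ge0.
by rewrite {2}/mxnorm1 mulr_suml; apply: ler_sum => i _; rewrite mulr_suml.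
Qed.

Definition resolvent (n : nat) (D : 'M[C]_n) (lam : C) : 'M[C]_n :=
  invmx (lam%:M - D).

Lemma unitmx_resolvent n (D : 'M[C]_n) lam :
  ~~ eigenvalue D lam -> lam%:M - D \in unitmx.
Proof.
rewrite negbK /eigenspace kermx_eq0 row_free_unit => h.
by rewrite -opprB -scaleN1r unitmxZ // unitrN1.
Qed.

Lemma resolventP n (D : 'M[C]_n) lam (y g : 'I_n -> C) : ~~ eigenvalue D lam ->
  (forall j, lam * y j - \sum_k D j k * y k = g j) <->
  (forall j, y j = \sum_k resolvent D lam j k * g k).
Proof.
move=> /unitmx_resolvent u.
have E : (lam%:M - D) *m (\col_k y k) = \col_j (lam * y j - \sum_k D j k * y k).
  apply/colP => j; rewrite mulmxBl mul_scalar_mx !mxE; congr (_ - _).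
  by apply: eq_bigr => k _; rewrite mxE.
have E' : resolvent D lam *m (\col_k g k) = \col_j (\sum_k resolvent D lam j k * g k).
  by apply/colP => j; rewrite !mxE; apply: eq_bigr => k _; rewrite mxE.
split=> h.
  have : resolvent D lam *m ((lam%:M - D) *m (\col_k y k)) = \col_k y k.
    by rewrite mulmxA mulVmx // mul1mx.
  have Eg : \col_j (lam * y j - \sum_k D j k * y k) = \col_j g j.
    by apply/colP => j; rewrite !mxE h.
  by rewrite E Eg E' => /colP yE j; have := yE j; rewrite !mxE.
have : (lam%:M - D) *m (resolvent D lam *m (\col_k g k)) = \col_k g k.
  by rewrite mulmxA mulmxV // mul1mx.
have Ey : \col_j (\sum_k resolvent D lam j k * g k) = \col_j y j.
  by apply/colP => j; rewrite !mxE -h.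
by rewrite E' Ey E => /colP yE j; have := yE j; rewrite !mxE.
Qed.

(* For small [lam] the resolvent [B] satisfies [B = P (lam B - 1)] with [P = D^-1]. *)
Lemma resolvent_near0 n (D : 'M[C]_n) lam : ~~ eigenvalue D 0 -> ~~ eigenvalue D lam ->
  normc lam * mxnorm1 (invmx D) <= 2^-1 ->
  mxnorm1 (resolvent D lam) <= 2 * mxnorm1 (invmx D).
Proof.
move=> /unitmx_resolvent; rewrite raddf0 sub0r -scaleN1r unitmxZ ?unitrN1 // => uD.
move=> /unitmx_resolvent u h; set B := resolvent D lam; set P := invmx D.
have : (lam%:M - D) *m B = 1%:M by rewrite mulmxV.
rewrite mulmxBl mul_scalar_mx => E.
have DB : D *m B = lam *: B - 1%:M by rewrite -E subKr.
have BE : B = lam *: (P *m B) - P.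
  by rewrite -{1}(mul1mx B) -(mulVmx uD) -mulmxA DB mulmxBr mulmx1 scalemxAr.
have := mxnorm1B (lam *: (P *m B)) P; rewrite -BE mxnorm1Z => h1.
have h2 := mxnorm1M P B.
have h3 : normc lam * mxnorm1 (P *m B) <= normc lam * mxnorm1 P * mxnorm1 B.
  by rewrite -mulrA ler_wpM2l ?normc_ge0.
have h4 : normc lam * mxnorm1 P * mxnorm1 B <= 2^-1 * mxnorm1 B.
  by rewrite ler_wpM2r ?mxnorm1_ge0.
lra.
Qed.

Lemma radius_below1 m (q : 'I_m -> C) : (forall i, normc (q i) < 1) ->
  exists x : R, [/\ 0 <= x, x < 1 & forall i, normc (q i) <= x].
Proof.
move=> q1; have [r r0 hr] : exists2 r, 0 < r & forall r' : R, 0 < r' <= r -> forall i, normc (q i) <= 1 - r'.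
  apply: finite_common_radius => i; exists (1 - normc (q i)); first by rewrite subr_gt0.
  by move=> r' /andP[_ h]; lra.
(* The cap at [1] keeps the resulting bound [1 - r'] nonnegative. *)
pose r' := Num.min r 1; have r'0 : 0 < r' by rewrite lt_min r0 ltr01.
have h1 : r' <= 1 by rewrite ge_min lexx orbT.
exists (1 - r'); split; [lra|lra|].
by apply: hr; rewrite r'0 ge_min lexx.
Qed.

Lemma multi_pow_outside_box m (q : 'I_m -> C) (x : R) N (a : mindex 'I_m) :
  0 <= x -> x < 1 -> (forall i, normc (q i) <= x) -> a \notin box _ N ->
  normc (multi_pow q a) <= x ^+ N.
Proof.
move=> x0 x1 qx; rewrite mem_box => /forallPn[k]; rewrite -leqNgt => Nk.
have q1 i : normc (q i) <= 1 by apply: le_trans (qx i) (ltW x1).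
rewrite normc_multi_pow (bigD1 k) //=.
have h1 : \prod_(j | j != k) normc (q j) ^+ a j <= 1.
  by apply: prodr_ile1 => j _; rewrite exprn_ge0 ?normc_ge0 // exprn_ile1 ?normc_ge0.
have h2 : normc (q k) ^+ a k <= x ^+ N.
  apply: (@le_trans _ _ (x ^+ a k)); first by rewrite lerXn2r ?nnegrE ?normc_ge0.
  by rewrite ler_wiXn2l // ltW.
rewrite -[leRHS]mulr1; apply: ler_pM => //; first by rewrite exprn_ge0 ?normc_ge0.
by rewrite prodr_ge0 // => j _; rewrite exprn_ge0 ?normc_ge0.
Qed.

(* All but finitely many [q^a] are close to [0], where the resolvent is bounded. *)
Lemma resolvent_bounded m n (q : 'I_m -> C) (D : 'M[C]_n) :
  (forall i, normc (q i) < 1) -> ~~ eigenvalue D 0 ->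
  (forall a : mindex 'I_m, a != zerom _ -> ~~ eigenvalue D (multi_pow q a)) ->
  exists2 K, 0 < K & forall a : mindex 'I_m, a != zerom _ ->
    forall j k, normc (resolvent D (multi_pow q a) j k) <= K.
Proof.
move=> /radius_below1[x [x0 x1 qx]] D0 Dq.
pose p := mxnorm1 (invmx D); have p0 : 0 <= p := mxnorm1_ge0 _.
(* Outside the box of size [N] this gives [normc (q^a) * p <= 2^-1], as [resolvent_near0] demands;
   [p + 1] avoids a division by zero. The box itself is finite and is covered by the sum [S]. *)
have [N hN] : exists N, x ^+ N <= (2 * (p + 1))^-1.
  by apply: exp_small => //; rewrite invr_gt0 mulr_gt0 // ltr_wpDl.
pose S := \sum_(a <- box _ N) mxnorm1 (resolvent D (multi_pow q a)).
have S0 : 0 <= S by apply: sumr_ge0 => a _; exact: mxnorm1_ge0.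
exists (2 * p + S + 1); first by lra.
move=> a a0 j k; apply: le_trans (mxnorm1_entry _ _ _) _.
have [aN|aN] := boolP (a \in box _ N).
  suff : mxnorm1 (resolvent D (multi_pow q a)) <= S by lra.
  rewrite /S (bigD1_seq a) ?box_uniq //= lerDl.
  by apply: sumr_ge0 => b _; exact: mxnorm1_ge0.
suff : mxnorm1 (resolvent D (multi_pow q a)) <= 2 * p by lra.
apply: (resolvent_near0 D0 (Dq _ a0)).
apply: (@le_trans _ _ ((2 * (p + 1))^-1 * p)).
  by rewrite ler_wpM2r //; apply: le_trans hN; exact: multi_pow_outside_box.
by rewrite mulrC ler_pdivrMr ?mulr_gt0 ?ltr_wpDl //; lra.
Qed.
End Resolvent.

Section ResolventOperator.
Variables (R : realType) (n : nat) (T : eqType).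
Local Notation C := R[i].

(** [P] marks the exponents at which no bound on the matrix is available; the result is cut to zero
    there. *)
Lemma l1_bound_resolvent (P : pred T) (B : T -> 'M[C]_n) (Kr : R) (g : 'I_n -> T -> C) e :
  0 <= Kr -> (forall t, ~~ P t -> forall j k, normc (B t j k) <= Kr) ->
  (forall k, l1_bound (g k) e) ->
  forall j, l1_bound (fun t => if P t then 0 else \sum_k B t j k * g k t) (n%:R * Kr * e).
Proof.
move=> Kr0 BK ge j.
have h k : l1_bound (fun t => if P t then 0 else B t j k * g k t) (Kr * e).
  have := l1_boundZ Kr%:C%C (ge k); rewrite normc_real_ge0 // => h.
  apply: l1_bound_le h _ _ => // t; case: ifPn => Pt; first by rewrite normc0 normc_ge0.
  by rewrite !normcM normc_real_ge0 // ler_wpM2r ?normc_ge0 ?BK.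
apply: l1_bound_le (l1_bound_sum (index_enum 'I_n) h) _ _ => [t|].
  case: ifP => // _; by rewrite normc0 normc_ge0.
by rewrite sumr_const card_ord -mulrA mulr_natl.
Qed.
End ResolventOperator.

(** * Lipschitz constants of substitution *)

Section Lipschitz.
Variables (R : realType) (J : finType).
Local Notation C := R[i].
Implicit Types (rho e : R) (d : J -> R).

(** For [N] factors the telescoped sum is at most [N rho^(N-1) e]; when [N >= 2] and [rho <= 2^-1],
    one factor [rho] can be set aside and the rest is at most [2]. *)
Lemma prod_diff_ge2 rho e d i k l : 0 <= rho <= 2^-1 -> 0 <= e -> (forall i, d i <= e) ->
  prod_diff (fun=> rho) d (i :: k :: l) <= 2 * rho * e.
Proof.
move=> /andP[rho0 rho2] e0 de.
have P1 (s : seq J) : 0 <= \prod_(j <- s) rho <= 1.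
  apply/andP; split; first by apply: prodr_ge0.
  by elim: s => [|j s IH]; rewrite ?big_nil // big_cons mulr_ile1 ?prodr_ge0 //; lra.
have Pl (s : seq J) (j : J) : 0 <= \prod_(j <- j :: s) rho <= rho.
  rewrite big_cons; have /andP[p0 p1] := P1 s; rewrite mulr_ge0 //=.
  by rewrite ler_piMr.
have step (s : seq J) (j : J) : d j * \prod_(j <- s) rho <= e * \prod_(j <- s) rho.
  by rewrite ler_wpM2r //; case/andP: (P1 s).
elim: l i k => [|h l IH] i k.
  rewrite /= big_nil; have := step [:: k] i; have /andP[p0 p1] := Pl [::] k.
  have := de k; move: p0 p1; set p := \prod_(_ <- _) _ => p0 p1 dk h1.
  have : e * p <= e * rho by rewrite ler_wpM2l.
  have : rho * d k <= rho * e by rewrite ler_wpM2l.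
  lra.
have := IH k h; set D := prod_diff _ _ (k :: h :: l) => hD.
rewrite -[leLHS]/(d i * \prod_(j <- k :: h :: l) rho + rho * D).
have := step (k :: h :: l) i; have /andP[p0 p1] := Pl (h :: l) k.
move: p0 p1; set p := \prod_(_ <- _) _ => p0 p1 h1.
have : e * p <= e * rho by rewrite ler_wpM2l.
have : rho * D <= rho * e by rewrite ler_wpM2l //; apply: le_trans hD _; nra.
lra.
Qed.

Lemma prod_diff_le rho e d l : 0 <= rho <= 2^-1 -> 0 <= e -> (forall i, d i <= e) ->
  prod_diff (fun=> rho) d l <= e.
Proof.
move=> rho2 e0 de; case: l => [//|i [|k l]].
  by rewrite /= big_nil mulr1 mulr0 addr0.
by apply: le_trans (prod_diff_ge2 _ _ _ rho2 e0 de) _; move/andP: rho2 => []; nra.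
Qed.

Lemma sum_bound_scale (T : eqType) (f : T -> C) K (k : T -> R) e : 0 <= e ->
  l1_bound f K -> (forall t, normc (f t) * k t <= normc (f t) * e) ->
  sum_bound (fun t => normc (f t) * k t) (K * e).
Proof.
move=> e0 fK h s us; apply: (@le_trans _ _ (\sum_(t <- s) normc (f t) * e)).
  exact: ler_sum.
by rewrite -mulr_suml ler_wpM2r // fK.
Qed.

Section Estimates.
Variables (I : finType) (c : mindex J -> C) (K rho e : R) (x x' : J -> mindex I -> C) (d : J -> R).
Hypotheses (cK : l1_bound c K) (rho2 : 0 <= rho <= 2^-1) (e0 : 0 <= e).
Hypotheses (xr : forall i, l1_bound (x i) rho) (xr' : forall i, l1_bound (x' i) rho).
Hypothesis xd : forall i, l1_bound (fun a => x i a - x' i a) (d i).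
Hypothesis de : forall i, d i <= e.

Let le1 : rho <= 1.
Proof. by move/andP: rho2 => []; lra. Qed.

Lemma l1_bound_comppsB_crude :
  l1_bound (fun a => compps c x a - compps c x' a) (K * e).
Proof.
have W (y : J -> mindex I -> C) : (forall i, l1_bound (y i) rho) -> forall i, l1_bound (y i) 1.
  by move=> yr i; apply: l1_boundW (yr i) le1.
apply: (l1_bound_comppsB (k := fun g => prod_diff (fun=> rho) d (factors g)) cK
  (W _ xr) (W _ xr')).
  by move=> g; exact: l1_bound_prodpsB xr xr' xd.
apply: sum_bound_scale => // g; rewrite ler_wpM2l ?normc_ge0 //.
exact: prod_diff_le.
Qed.

(** The small factor [rho] is missing only for monomials consisting of a single variable; the
    hypothesis says that such a monomial is absent or its variable is held fixed. *)
Lemma l1_bound_comppsB_small :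
  (forall i, c (unitm i) = 0 \/ d i <= 0) ->
  l1_bound (fun a => compps c x a - compps c x' a) (K * (2 * rho * e)).
Proof.
move=> lin; have W (y : J -> mindex I -> C) : (forall i, l1_bound (y i) rho) -> forall i, l1_bound (y i) 1.
  by move=> yr i; apply: l1_boundW (yr i) le1.
have re0 : 0 <= 2 * rho * e by case/andP: rho2 => *; rewrite !mulr_ge0.
apply: (l1_bound_comppsB (k := fun g => prod_diff (fun=> rho) d (factors g)) cK
  (W _ xr) (W _ xr')).
  by move=> g; exact: l1_bound_prodpsB xr xr' xd.
apply: sum_bound_scale => // g; case E : (factors g) => [|i [|k l]].
- by rewrite ler_wpM2l ?normc_ge0.
- have gi : g = unitm i.
    by apply/ffunP => j; rewrite -count_factors E ffunE /= addn0 eq_sym.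
  case: (lin i) => [c0|di]; first by rewrite gi c0 normc0 !mul0r.
  rewrite ler_wpM2l ?normc_ge0 //= big_nil mulr1 mulr0 addr0.
  exact: le_trans di re0.
- by rewrite ler_wpM2l ?normc_ge0 ?prod_diff_ge2.
Qed.
End Estimates.
End Lipschitz.


(** * Dilations, linearity of substitution and choice of radii *)

Section Preliminaries.
Variable R : realType.
Local Notation C := R[i].

Lemma unitm_inj (I : finType) : injective (@unitm I).
Proof.
move=> i j /ffunP/(_ i); rewrite !ffunE eqxx; by case: eqP.
Qed.

Lemma ev_dilate (I : finType) (c : mindex I -> C) (u z : I -> C) :
  ev (fun a : mindex I => multi_pow u a * c a) z = ev c (fun i => u i * z i).
Proof.
by congr total; apply: funext => a; rewrite multi_powM mulrCA mulrA.
Qed.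

Lemma l1_bound_dilate (I : finType) (c : mindex I -> C) (u : I -> C) K :
  in_unit u -> l1_bound c K -> l1_bound (fun a : mindex I => multi_pow u a * c a) K.
Proof.
move=> u1 cK; apply: l1_bound_le cK _ _ => // a.
by rewrite normcM ler_piMl ?normc_ge0 ?normc_multi_pow_le1.
Qed.

Lemma in_unitM (I : finType) (u z : I -> C) : in_unit u -> in_unit z ->
  in_unit (fun i => u i * z i).
Proof. by move=> u1 z1 i; rewrite normcM mulr_ile1 ?normc_ge0. Qed.

(** Linearity in the outer series, read off from values by the identity theorem. *)
Lemma comppsB_coef (J I : finType) (c c' : mindex J -> C) K K' (x : J -> mindex I -> C) :
  l1_bound c K -> l1_bound c' K' -> (forall i, l1_bound (x i) 1) ->
  compps (fun g => c g - c' g) x = (fun a => compps c x a - compps c' x a).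
Proof.
move=> cK cK' x1; apply: funext => a.
have cc := l1_boundB cK cK'.
apply: (ev_inj (l1_bound_compps cc x1)
  (l1_boundB (l1_bound_compps cK x1) (l1_bound_compps cK' x1))) => z z1.
 rewrite (ev_compps cc) //.
rewrite (evB z1 (l1_bound_compps cK x1) (l1_bound_compps cK' x1)).
rewrite (evB (in_unit_ev x1 z1) cK cK').
by rewrite (ev_compps cK) // (ev_compps cK').
Qed.

(** Two linear smallness conditions at once; a slope [0] stands for an absent condition. *)
Lemma small_radius (A B a b bnd : R) : 0 < a -> 0 < b -> 0 < bnd ->
  exists r, [/\ 0 < r, r <= bnd, A * r <= a & B * r <= b].
Proof.
move=> a0 b0 bnd0.
have sm (X x : R) : 0 < x -> exists2 r, 0 < r & forall r', 0 < r' -> r' <= r -> X * r' <= x.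
  move=> x0; have X0 : 0 < `|X| + 1 by rewrite ltr_wpDl.
  exists (x / (`|X| + 1)); first exact: divr_gt0.
  move=> r' r'0; rewrite ler_pdivlMr // => h; have := ler_norm X; nra.
have [r1 r10 h1] := sm A a a0; have [r2 r20 h2] := sm B b b0.
have r0 : 0 < Num.min bnd (Num.min r1 r2) by rewrite !lt_min bnd0 r10.
exists (Num.min bnd (Num.min r1 r2)); split=> //.
- by rewrite ge_min lexx.
- by apply: h1 => //; rewrite !ge_min lexx !orbT.
- by apply: h2 => //; rewrite !ge_min lexx !orbT.
Qed.
End Preliminaries.

(** * Splitting off the terms linear in [y] *)

Section LinearPart.
Variables (R : realType) (m n : nat).
Local Notation C := R[i].
Local Notation J := (('I_m + 'I_n) + 'I_m)%type.

Definition yvar (k : 'I_n) : J := inl (inr k).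

Definition linpart (c : 'I_n -> mindex J -> C) : 'M[C]_n :=
  \matrix_(j, k) c j (unitm (yvar k)).

(** The series [c'] of the overview. Linear terms in [t] or [s] remain, harmlessly: two arguments
    being compared in the contraction estimate differ only in [y]. *)
Definition nonlin (c : mindex J -> C) : mindex J -> C :=
  fun g => if [exists k, g == unitm (yvar k)] then 0 else c g.

Lemma nonlin_unitm c i : nonlin c (unitm i) = 0 \/ (forall k, i != yvar k).
Proof.
rewrite /nonlin; case: existsP => [_|h]; [by left|right=> k].
by apply/eqP => ik; apply: h; exists k; rewrite ik.
Qed.

Lemma l1_bound_nonlin c K : l1_bound c K -> l1_bound (nonlin c) K.
Proof.
move=> cK; apply: l1_bound_le cK _ _ => // g; rewrite /nonlin.
by case: ifP; rewrite ?normc0 ?normc_ge0.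
Qed.

Lemma ev_nonlin c K w : l1_bound c K -> in_unit w ->
  ev c w = ev (nonlin c) w + \sum_k c (unitm (yvar k)) * w (yvar k).
Proof.
move=> cK w1.
have mb k := l1_bound_monom (c (unitm (yvar k))) (unitm (yvar k)).
have cE : c = (fun g => nonlin c g + \sum_k monom (c (unitm (yvar k))) (unitm (yvar k)) g).
  apply: funext => g; rewrite /nonlin; case: existsP => [[k /eqP ->]|h].
    rewrite add0r (bigD1 k) //= /monom eqxx big1 ?addr0 // => k' kk'.
    case: eqP => // /unitm_inj[] E; by rewrite E eqxx in kk'.
  rewrite big1 ?addr0 // => k _; rewrite /monom; case: eqP => // E.
  by case: h; exists k; rewrite E.
rewrite [in LHS]cE (evD w1 (l1_bound_nonlin cK) (l1_bound_sum _ mb)) (ev_sum _ w1 mb).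
congr (_ + _); apply: eq_bigr => k _.
by rewrite ev_monom multi_pow_unit.
Qed.

Definition jvars (I : finType) (X : 'I_m -> mindex I -> C) (y : 'I_n -> mindex I -> C)
  (S : 'I_m -> mindex I -> C) : J -> mindex I -> C :=
  fun w => match w with inl (inl i) => X i | inl (inr k) => y k | inr i => S i end.

Lemma ev_jvars (I : finType) (X : 'I_m -> mindex I -> C) y S z :
  (fun i => ev (jvars X y S i) z) =
  join3 (fun i => ev (X i) z) (fun k => ev (y k) z) (fun i => ev (S i) z).
Proof. by apply: funext => -[[i|k]|i]. Qed.
End LinearPart.

(** * Uniqueness of small solutions at a fixed parameter *)

Section Uniqueness.
Variables (R : realType) (m n : nat).
Local Notation C := R[i].
Local Notation J := (('I_m + 'I_n) + 'I_m)%type.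
Variables (c : 'I_n -> mindex J -> C) (K Kr rho rt : R) (q : 'I_m -> C).
Hypotheses (cK : forall j, l1_bound (c j) K) (q1 : in_unit q).
Local Notation D := (linpart c).
Hypothesis Dq : forall a : mindex 'I_m, a != zerom _ -> ~~ eigenvalue D (multi_pow q a).
Hypothesis Kr0 : 0 <= Kr.
Hypothesis DKr : forall a : mindex 'I_m, a != zerom _ ->
  forall j k, normc (resolvent D (multi_pow q a) j k) <= Kr.
Hypotheses (rho2 : 0 <= rho <= 2^-1) (rt0 : 0 <= rt <= rho).
Hypothesis small : n%:R * Kr * (K * (2 * rho)) <= 2^-1.

(** The last argument [zerov] is the value of [s]: the parameter is the centre itself. The factor
    [rt] is the radius in [t], already shrunk so that [y] fits into the ball of radius [rho]. *)
Definition scaled_solution (y : 'I_n -> mindex 'I_m -> C) :=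
  [/\ forall j, l1_bound (y j) rho, forall j, y j (zerom _) = 0 &
      forall z, in_unit z -> forall j,
        ev (y j) (fun i => q i * z i) =
        ev (c j) (join3 (fun i => rt%:C%C * z i) (fun k => ev (y k) z) zerov)].

Let vars (y : 'I_n -> mindex 'I_m -> C) :=
  jvars (fun i => monom rt%:C%C (unitm i)) y (fun=> (fun=> 0)).

Let vars_bound y : (forall j, l1_bound (y j) rho) -> forall i, l1_bound (vars y i) rho.
Proof.
case/andP: rho2 => r0 _; case/andP: rt0 => t0 t1 yr [[i|k]|i] //=.
  by apply: l1_boundW (l1_bound_monom _ _) _; rewrite normc_real_ge0.
by apply: l1_boundW (@l1_bound0 _ _) r0.
Qed.

Let rho1 : rho <= 1.
Proof. by case/andP: rho2; lra. Qed.

Let vars_bound1 y : (forall j, l1_bound (y j) rho) -> forall i, l1_bound (vars y i) 1.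
Proof. by move=> yr i; apply: l1_boundW rho1; exact: vars_bound. Qed.

Let coef_eq y : scaled_solution y -> forall j (a : mindex 'I_m),
  multi_pow q a * y j a - \sum_k D j k * y k a = compps (nonlin (c j)) (vars y) a.
Proof.
move=> [yr _ yE] j; have x1 := vars_bound1 yr.
have nl := l1_bound_nonlin (cK j).
have yq := l1_bound_dilate q1 (yr j).
have yD k := l1_boundZ (D j k) (yr k).
apply: ev_inj (l1_boundB yq (l1_bound_sum _ yD)) (l1_bound_compps nl x1) _ => z z1.
rewrite (evB z1 yq (l1_bound_sum _ yD)) (ev_sum _ z1 yD) ev_dilate (yE z z1 j).
rewrite (ev_compps nl x1 z1).
have wE : (fun i => ev (vars y i) z) =
    join3 (fun i => rt%:C%C * z i) (fun k => ev (y k) z) zerov.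
  rewrite ev_jvars; congr join3; apply: funext => i.
    by rewrite ev_monom multi_pow_unit.
  by rewrite ev_0coef.
have w1 := in_unit_ev x1 z1; rewrite wE in w1 *.
(* The linear terms of [c] cancel against the subtracted [D y]. *)
rewrite (ev_nonlin (cK j) w1) -addrA -sumrB big1 ?addr0 // => k _.
by rewrite (evZ _ z1 (yr k)) mxE subrr.
Qed.

(** The difference is the resolvent applied to a difference of nonlinear terms, so any bound on its
    norm may be halved; starting from [rho + rho], it is zero. *)
Lemma scaled_solution_unique y y' : scaled_solution y -> scaled_solution y' ->
  forall j a, y j a = y' j a.
Proof.
move=> sy sy' j a; apply/eqP; rewrite -subr_eq0; apply/eqP.
have [yr y0 _] := sy; have [yr' y0' _] := sy'.
pose d j a := y j a - y' j a.
pose g k a := compps (nonlin (c k)) (vars y) a - compps (nonlin (c k)) (vars y') a.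
have dE i : d i = fun b => if b == zerom _ then 0
    else \sum_k resolvent D (multi_pow q b) i k * g k b.
  apply: funext => b; rewrite /d; case: eqP => [->|/eqP b0]; first by rewrite y0 y0' subr0.
  have := proj1 (resolventP (fun k => d k b) (fun k => g k b) (Dq b0)); apply=> k.
  rewrite /g -(coef_eq sy) -(coef_eq sy') /d mulrBr; under eq_bigr do rewrite mulrBr.
  rewrite sumrB; ring.
have half e : (forall j, l1_bound (d j) e) -> forall j, l1_bound (d j) (e / 2).
  move=> de i; have e0 := l1_bound_ge0 (de i).
  have ge k : l1_bound (g k) (K * (2 * rho * e)).
    apply: (@l1_bound_comppsB_small _ _ _ _ _ _ _ _ _
      (fun w : J => if w is inl (inr _) then e else 0)) => //.
    - exact: l1_bound_nonlin.
    - exact: vars_bound.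
    - exact: vars_bound.
    - move=> [[u|u]|u] /=; [|exact: de|];
        by apply: l1_bound_le (@l1_bound0 _ _) _ _ => // t; rewrite subrr.
    - by move=> [[u|u]|u].
    - move=> w; case: (nonlin_unitm (c k) w) => [|p]; [by left|right].
      by case: w p => [[u|u]|u] // /(_ u); rewrite eqxx.
  rewrite dE; apply: l1_boundW (l1_bound_resolvent Kr0 DKr ge i) _.
  have := ler_wpM2r e0 small; nra.
have dk k : forall i, l1_bound (d i) ((rho + rho) * 2^-1 ^+ k).
  elim: k => [|k IH] i; first by rewrite expr0 mulr1; exact: l1_boundB.
  by have := half _ IH i; rewrite exprSr mulrA.
move: a; apply: l1_bound_eq0 => e e0.
have [N hN] := @exp_small R 2^-1 e ltac:(lra) ltac:(lra) e0.
apply: l1_boundW (dk N j) _; apply: le_trans hN.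
by rewrite ler_piMl ?exprn_ge0 ?invr_ge0 //; case/andP: rho2; lra.
Qed.
End Uniqueness.


(** * Existence of a solution jointly holomorphic in [t] and [s] *)

Section Existence.
Variables (R : realType) (m n : nat).
Local Notation C := R[i].
Local Notation J := (('I_m + 'I_n) + 'I_m)%type.
Local Notation S := ('I_m + 'I_m)%type.
Implicit Types (z : S -> C) (u : mindex S -> C) (a : mindex S).

Definition tpart a : mindex 'I_m := [ffun i => a (inl i)].
Definition tzero z : S -> C := fun i => if i is inr k then z (inr k) else 0.

Lemma in_unit_tzero z : in_unit z -> in_unit (tzero z).
Proof. by move=> z1 [i|i]; rewrite /tzero ?normc0 //; exact: z1. Qed.

Lemma ev_tzero u z :
  ev u (tzero z) = ev (fun a => if tpart a == zerom _ then u a else 0) z.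
Proof.
congr total; apply: funext => a; case: eqP => [a0|/eqP a0].
  congr (_ * _); apply: eq_bigr => -[i|i] _ //=.
  by have /ffunP/(_ i) := a0; rewrite !ffunE => ->; rewrite !expr0.
have [i ai] : exists i, a (inl i) != 0%N.
  apply/existsP; apply: contraNT a0; rewrite negb_exists => /forallP h.
  by apply/eqP/ffunP => i; rewrite !ffunE; apply/eqP; move: (h i); rewrite negbK.
by rewrite /multi_pow (bigD1 (inl i)) //= expr0n (negPf ai) mul0r mulr0 mul0r.
Qed.

Section Dilation.
Variables (q : 'I_m -> C) (s theta : R).
Hypotheses (s0 : 0 <= s) (theta1 : theta < 1) (qs : forall i, normc (q i) + s <= theta).

Definition tdil : S -> C := fun i => if i is inl k then q k else 1.

Lemma multi_pow_tdil a : multi_pow tdil a = multi_pow q (tpart a).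
Proof.
rewrite /multi_pow big_sumType /= [X in _ * X]big1 ?mulr1 => [|i _]; last by rewrite expr1n.
by apply: eq_bigr => i _; rewrite ffunE.
Qed.

Let q_theta i : normc (q i) <= theta.
Proof. by apply: le_trans (qs i); rewrite lerDl. Qed.

Lemma in_unit_tdil : in_unit tdil.
Proof.
move=> [i|i]; rewrite /tdil ?normc1 //.
exact: le_trans (q_theta i) (ltW theta1).
Qed.

(* [(q_i + s X_i) T_i] and [X_i], the arguments of the solution on the left-hand side. *)
Definition dvars : S -> mindex S -> C := fun i => match i with
  | inl k => fun a => monom (q k) (unitm (inl k)) a
                      + monom s%:C%C (addm (unitm (inl k)) (unitm (inr k))) a
  | inr k => monom 1 (unitm (inr k)) end.

Definition dvars0 : S -> mindex S -> C := fun i => monom (tdil i) (unitm i).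

Definition dpoint z : S -> C := fun i => match i with
  | inl k => (q k + s%:C%C * z (inr k)) * z (inl k) | inr k => z (inr k) end.

Let M : S -> R := fun i => if i is inl _ then theta else 1.

Let dvars_bound i : l1_bound (dvars i) (M i).
Proof.
case: i => i /=; last by rewrite -(@normc1 R); exact: l1_bound_monom.
apply: l1_boundW (l1_boundD (l1_bound_monom _ _) (l1_bound_monom _ _)) _.
by rewrite normc_real_ge0.
Qed.

Let dvars0_bound i : l1_bound (dvars0 i) (M i).
Proof.
apply: l1_boundW (l1_bound_monom _ _) _; by case: i => i; rewrite /tdil /M ?normc1.
Qed.

Let M1 i : M i <= 1.
Proof. by case: i => i //=; exact: ltW. Qed.

Lemma dvars_bound1 i : l1_bound (dvars i) 1.
Proof. exact: l1_boundW (dvars_bound i) (M1 i). Qed.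

Let dvars0_bound1 i : l1_bound (dvars0 i) 1.
Proof. exact: l1_boundW (dvars0_bound i) (M1 i). Qed.

Lemma ev_dvars z : in_unit z -> (fun i => ev (dvars i) z) = dpoint z.
Proof.
move=> z1; apply: funext => -[i|i] /=; last by rewrite ev_monom multi_pow_unit mul1r.
rewrite (evD z1 (l1_bound_monom _ _) (l1_bound_monom _ _)) !ev_monom multi_powD.
by rewrite !multi_pow_unit; ring.
Qed.

Let compps_dvars0 u K : l1_bound u K ->
  compps u dvars0 = (fun a => multi_pow tdil a * u a).
Proof.
move=> uK; apply: funext => a.
apply: (ev_inj (l1_bound_compps uK dvars0_bound1) (l1_bound_dilate in_unit_tdil uK)) => z z1.
rewrite (ev_compps uK dvars0_bound1 z1) ev_dilate; congr ev; apply: funext => i.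
by rewrite ev_monom multi_pow_unit.
Qed.

(** The bound does not depend on the length of [l]: each [t]-factor contributes [s] and damps what
    follows by [theta], so the sum is dominated by [s (1 + theta + theta^2 + ...)]. *)
Let prod_diff_dvars l :
  0 <= \prod_(j <- l) M j <= 1 /\
  prod_diff M (fun i => if i is inl _ then s else 0) l <= s / (1 - theta).
Proof.
have th0 i : 0 <= M i.
  by case: i => i //=; apply: le_trans (normc_ge0 _) (q_theta i).
have h0 : 0 < 1 - theta by rewrite subr_gt0.
(* The limit of the geometric series is fixed by one step of the recursion, hence is an invariant of
   the induction. *)
have B : s / (1 - theta) = s + theta * (s / (1 - theta)).
  by field; rewrite gt_eqF.
elim: l => [|i l [/andP[p0 p1] IH]].
  by rewrite big_nil /= lexx ler01 divr_ge0 // ltW.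
rewrite big_cons /=; split; first by rewrite mulr_ge0 //= mulr_ile1.
case: i => i /=; last by rewrite mul0r mul1r add0r.
have t0 := th0 (inl i).
have : s * \prod_(j <- l) M j <= s by rewrite ler_piMr.
have := ler_wpM2l t0 IH; rewrite /= in t0 *; lra.
Qed.

(** The term [y((q0 + s) t, s) - y(q0 t, s)] as an operator on coefficients. *)
Definition dilB u : mindex S -> C := fun a => compps u dvars a - multi_pow tdil a * u a.

Lemma l1_bound_dilB u K : l1_bound u K -> l1_bound (dilB u) (K * (s / (1 - theta))).
Proof.
(* The diagonal dilation is itself a substitution, so the telescoping estimate for differences of
   substitutions applies. *)
move=> uK; have := compps_dvars0 uK => /(congr1 (fun f a => compps u dvars a - f a)).
rewrite -/(dilB u) => <-.
apply: (l1_bound_comppsB (k := fun g => prod_diff M (fun i => if i is inl _ then s else 0) (factors g))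
  uK dvars_bound1 dvars0_bound1) => [g|].
  apply: l1_bound_prodpsB => // -[i|i] /=; last first.
    by apply: l1_bound_le (@l1_bound0 _ _) _ _ => // a; rewrite subrr.
  have := l1_bound_monom s%:C%C (addm (unitm (inl i : S)) (unitm (inr i))).
  rewrite normc_real_ge0 // => h; apply: l1_bound_le h _ _ => // a.
  by rewrite /dvars0 /= addrAC subrr add0r.
apply: sum_bound_scale => //; first by rewrite divr_ge0 // subr_ge0 ltW.
by move=> g; rewrite ler_wpM2l ?normc_ge0 //; case: (prod_diff_dvars (factors g)).
Qed.

Lemma dilBB u u' K K' : l1_bound u K -> l1_bound u' K' ->
  dilB (fun a => u a - u' a) = fun a => dilB u a - dilB u' a.
Proof.
move=> uK uK'; apply: funext => a; rewrite /dilB (comppsB_coef uK uK' dvars_bound1).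
ring.
Qed.

Lemma ev_dilB u K z : l1_bound u K -> in_unit z ->
  ev (dilB u) z = ev u (dpoint z) - ev u (fun i => tdil i * z i).
Proof.
move=> uK z1.
rewrite (evB z1 (l1_bound_compps uK dvars_bound1) (l1_bound_dilate in_unit_tdil uK)).
by rewrite (ev_compps uK dvars_bound1 z1) ev_dilate ev_dvars.
Qed.
End Dilation.

Section FixedPointEquation.
Variables (c : 'I_n -> mindex J -> C) (K Kr rho rt rs s theta : R) (q : 'I_m -> C).
Hypothesis cK : forall j, l1_bound (c j) K.
Local Notation D := (linpart c).
Hypothesis Dq : forall a : mindex 'I_m, a != zerom _ -> ~~ eigenvalue D (multi_pow q a).
Hypothesis Kr0 : 0 <= Kr.
Hypothesis DKr : forall a : mindex 'I_m, a != zerom _ ->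
  forall j k, normc (resolvent D (multi_pow q a) j k) <= Kr.
Hypotheses (rho0 : 0 < rho) (rho2 : rho <= 2^-1).
Hypotheses (rt0 : 0 <= rt <= rho) (rs0 : 0 <= rs <= rho) (s0 : 0 <= s).
Hypotheses (theta1 : theta < 1) (qs : forall i, normc (q i) + s <= theta).
Hypothesis small : n%:R * Kr * (K * (2 * rho) + s / (1 - theta)) <= 2^-1.
Hypothesis smallt : n%:R * Kr * (K * rt) <= rho / 2.
Hypothesis vanish : forall v : 'I_m -> C, in_unit v -> forall j, ev (c j) (join3 zerov zerov v) = 0.

Let vars (y : 'I_n -> mindex S -> C) : J -> mindex S -> C :=
  jvars (fun i => monom rt%:C%C (unitm (inl i))) y (fun i => monom rs%:C%C (unitm (inr i))).

Let rhoP : 0 <= rho <= 2^-1. Proof. by rewrite ltW. Qed.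

Let rho1 : rho <= 1. Proof. by move: rho2; lra. Qed.

Let vars_bound y : (forall j, l1_bound (y j) rho) -> forall i, l1_bound (vars y i) rho.
Proof.
case/andP: rt0 => t0 t1; case/andP: rs0 => s0' s1 yr [[i|k]|i] //=.
  by apply: l1_boundW (l1_bound_monom _ _) _; rewrite normc_real_ge0.
by apply: l1_boundW (l1_bound_monom _ _) _; rewrite normc_real_ge0.
Qed.

Let vars_bound1 y : (forall j, l1_bound (y j) rho) -> forall i, l1_bound (vars y i) 1.
Proof. by move=> yr i; apply: l1_boundW rho1; exact: vars_bound. Qed.

Let ev_vars y z : (fun i => ev (vars y i) z) =
  join3 (fun i => rt%:C%C * z (inl i)) (fun k => ev (y k) z) (fun i => rs%:C%C * z (inr i)).
Proof.
by rewrite ev_jvars; congr join3; apply: funext => i; rewrite ev_monom multi_pow_unit.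
Qed.

Let rhs y k a := compps (nonlin (c k)) (vars y) a - dilB q s (y k) a.

(** At exponents without [t] the multiplier is [1], possibly an eigenvalue; the value [0] there
    encodes [y = 0] at [t = 0]. *)
Let Phi (y : 'I_n -> mindex S -> C) j a : C := if tpart a == zerom _ then 0
  else \sum_k resolvent D (multi_pow q (tpart a)) j k * rhs y k a.

Let Phi_contr y y' e :
  (forall j, l1_bound (y j) rho) -> (forall j, l1_bound (y' j) rho) ->
  (forall j, l1_bound (fun a => y j a - y' j a) e) ->
  forall j, l1_bound (fun a => Phi y j a - Phi y' j a) (e / 2).
Proof.
move=> yr yr' ye j; have e0 := l1_bound_ge0 (ye j).
have ge k : l1_bound (fun a => rhs y k a - rhs y' k a)
    (K * (2 * rho * e) + e * (s / (1 - theta))).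
  have h1 : l1_bound (fun a => compps (nonlin (c k)) (vars y) a - compps (nonlin (c k)) (vars y') a)
      (K * (2 * rho * e)).
    apply: (@l1_bound_comppsB_small _ _ _ _ _ _ _ _ _
      (fun w : J => if w is inl (inr _) then e else 0)) => //.
    - exact: l1_bound_nonlin.
    - exact: vars_bound.
    - exact: vars_bound.
    - move=> [[v|v]|v] /=; [|exact: ye|];
        by apply: l1_bound_le (@l1_bound0 _ _) _ _ => // t; rewrite subrr.
    - by move=> [[v|v]|v].
    - move=> w; case: (nonlin_unitm (c k) w) => [|p]; [by left|right].
      by case: w p => [[v|v]|v] // /(_ v); rewrite eqxx.
  have h2 := l1_bound_dilB s0 theta1 qs (ye k).
  rewrite (dilBB s0 theta1 qs (yr k) (yr' k)) in h2.
  apply: l1_bound_le (l1_boundB h1 h2) _ _ => // a; rewrite /rhs.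
  set A := _ - _; set B := _ - _; suff -> : A = B by [].
  by rewrite /A /B; ring.
have := l1_bound_resolvent (P := fun a => tpart a == zerom _) Kr0 (fun a => @DKr (tpart a)) ge j.
move=> h; apply: l1_bound_le h _ _ => [a|].
  rewrite /Phi; case: ifP => _; first by rewrite subrr.
  by rewrite -sumrB; under eq_bigr do rewrite -mulrBr.
have := ler_wpM2r e0 small; nra.
Qed.

Let dilB0 : dilB q s (fun=> 0) = fun=> 0.
Proof.
apply: funext => a; apply: l1_bound_eq0 => e e0.
have := l1_bound_dilB s0 theta1 qs (@l1_bound0 R (mindex S)).
by rewrite mul0r => h; apply: l1_boundW h _; exact: ltW.
Qed.

Let nonlin_vanish v j : in_unit v -> ev (nonlin (c j)) (join3 zerov zerov v) = 0.
Proof.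
move=> v1; have w1 : in_unit (join3 (zerov : 'I_m -> C) (zerov : 'I_n -> C) v).
  by move=> [[i|i]|i]; rewrite /join3 /zerov ?normc0 //; exact: v1.
have := ev_nonlin (cK j) w1; rewrite vanish // big1 ?addr0 => [->|k _] //.
by rewrite /= mulr0.
Qed.

(** The nonlinear part vanishes at [(0, 0, s)], and [(t, 0, s)] differs from that point only by [t],
    of size [rt]. Linear terms in [t] may occur, so the crude Lipschitz constant is the right
    one. *)
Let Phi_0 j : l1_bound (Phi (fun _ _ => 0) j) (rho / 2).
Proof.
pose x00 : J -> mindex S -> C := jvars (fun _ _ => 0) (fun _ _ => 0) (fun i => monom rs%:C%C (unitm (inr i))).
have z0r (i : 'I_n) : l1_bound ((fun _ _ => 0) i : mindex S -> C) rho.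
  by apply: l1_boundW (@l1_bound0 _ _) _; exact: ltW.
have x00r i : l1_bound (x00 i) rho.
  have h := vars_bound z0r i; case: i h => [[i|i]|i] //= _.
  exact: (z0r j).
have x001 i : l1_bound (x00 i) 1 by apply: l1_boundW (x00r i) rho1.
have cx0 k a : compps (nonlin (c k)) x00 a = 0.
  move: a; apply: (ev_eq0 (l1_bound_compps (l1_bound_nonlin (cK k)) x001)) => z z1.
  rewrite (ev_compps (l1_bound_nonlin (cK k)) x001 z1).
  have -> : (fun i => ev (x00 i) z) = join3 zerov zerov (fun i => rs%:C%C * z (inr i)).
    rewrite ev_jvars; congr join3; apply: funext => i; rewrite ?ev_0coef //.
    by rewrite ev_monom multi_pow_unit.
  apply: nonlin_vanish => i; rewrite normcM mulr_ile1 ?normc_ge0 //.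
  by case/andP: rs0 => h1 h2; rewrite normc_real_ge0 //; apply: le_trans h2 rho1.
have t0 : 0 <= rt by case/andP: rt0.
have ge k : l1_bound (rhs (fun _ _ => 0) k) (K * rt).
  have := @l1_bound_comppsB_crude _ _ _ _ _ _ rt (vars (fun _ _ => 0)) x00
    (fun w : J => if w is inl (inl _) then rt else 0) (l1_bound_nonlin (cK k)) rhoP t0
    (vars_bound z0r) x00r.
  move=> h; apply: l1_bound_le (h _ _) _ _ => //.
  - move=> [[i|i]|i] /=.
    + have h' := l1_bound_monom rt%:C%C (unitm (inl i : S)).
      rewrite normc_real_ge0 // in h'.
      by apply: l1_bound_le h' _ _ => // a; rewrite subr0.
    + by apply: l1_bound_le (@l1_bound0 _ _) _ _ => // a; rewrite subrr.
    + by apply: l1_bound_le (@l1_bound0 _ _) _ _ => // a; rewrite subrr.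
  - by move=> [[i|i]|i].
  - by move=> a; rewrite /rhs cx0 dilB0.
have h := l1_bound_resolvent (P := fun a => tpart a == zerom _) Kr0 (fun a => @DKr (tpart a)) ge j.
exact: l1_boundW h smallt.
Qed.

Lemma scaled_solution_exists : exists y : 'I_n -> mindex S -> C,
  [/\ forall j, l1_bound (y j) rho,
      forall j z, in_unit z -> ev (y j) (tzero z) = 0 &
      forall j z, in_unit z -> ev (y j) (dpoint q s z) =
        ev (c j) (join3 (fun i => rt%:C%C * z (inl i)) (fun k => ev (y k) z)
                        (fun i => rs%:C%C * z (inr i)))].
Proof.
have [y [yr yE]] := contraction_fixpoint rho0 Phi_contr Phi_0.
have y0 j z : in_unit z -> ev (y j) (tzero z) = 0.
  move=> z1; rewrite ev_tzero -[RHS](ev_0coef z); congr ev; apply: funext => a.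
  by case: ifP => // a0; rewrite -(yE j a) /Phi a0.
exists y; split=> // j z z1.
have nlb k := l1_bound_compps (l1_bound_nonlin (cK k)) (vars_bound1 yr).
have dlb k := l1_bound_dilB s0 theta1 qs (yr k).
have rb k := l1_boundB (nlb k) (dlb k).
have evr k w : in_unit w -> ev (rhs y k) w =
    ev (nonlin (c k)) (join3 (fun i => rt%:C%C * w (inl i)) (fun k => ev (y k) w)
                             (fun i => rs%:C%C * w (inr i)))
    - (ev (y k) (dpoint q s w) - ev (y k) (fun i => tdil q i * w i)).
  move=> w1; rewrite (evB w1 (nlb k) (dlb k)) (ev_dilB s0 theta1 qs (yr k) w1).
  by rewrite (ev_compps (l1_bound_nonlin (cK k)) (vars_bound1 yr) w1) ev_vars.
(* [Phi] carries no information at these exponents, so the equation is verified there separately: at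
   [t = 0] the solution is zero, both dilations act trivially, and the nonlinear part vanishes. *)
have rhs0 k a : tpart a = zerom _ -> rhs y k a = 0.
  move=> a0; pose r a := if tpart a == zerom _ then rhs y k a else 0.
  have rK : l1_bound r (K + rho * (s / (1 - theta))).
    apply: l1_bound_le (rb k) _ _ => // b; rewrite /r.
    by case: ifP => // _; rewrite normc0 normc_ge0.
  suff : r a = 0 by rewrite /r a0 eqxx.
  move: a {a0}; apply: (ev_eq0 rK) => w w1.
  have w01 := in_unit_tzero w1.
  rewrite /r -ev_tzero evr //.
  have -> : dpoint q s (tzero w) = tzero w.
    by apply: funext => -[i|i] //=; rewrite mulr0.
  have -> : (fun i => tdil q i * tzero w i) = tzero w.
    by apply: funext => -[i|i] //=; rewrite ?mulr0 ?mul1r.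
  rewrite subrr subr0 /=.
  have -> : (fun _ : 'I_m => rt%:C%C * 0) = zerov :> ('I_m -> C).
    by apply: funext => i; rewrite mulr0.
  have -> : (fun k => ev (y k) (tzero w)) = zerov by apply: funext => k'; rewrite y0.
  apply: nonlin_vanish => i; rewrite normcM mulr_ile1 ?normc_ge0 //.
  by case/andP: rs0 => h1 h2; rewrite normc_real_ge0 //; apply: le_trans h2 rho1.
have coef a : multi_pow (tdil q) a * y j a - \sum_k D j k * y k a = rhs y j a.
  rewrite multi_pow_tdil; have [a0|a0] := eqVneq (tpart a) (zerom _).
    have yz k : y k a = 0 by rewrite -yE /Phi a0 eqxx.
    by rewrite rhs0 // yz mulr0 big1 ?subr0 // => k _; rewrite yz mulr0.
  have := proj2 (resolventP (fun k => y k a) (fun k => rhs y k a) (Dq a0)); apply=> k.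
  by rewrite -{1}(yE k a) /Phi (negPf a0).
have yq := l1_bound_dilate (in_unit_tdil s0 theta1 qs) (yr j).
have yD k := l1_boundZ (D j k) (yr k).
have := congr1 (fun f => ev f z) (funext coef).
rewrite (evB z1 yq (l1_bound_sum _ yD)) (ev_sum _ z1 yD) ev_dilate evr //.
have w1 := in_unit_ev (vars_bound1 yr) z1; rewrite ev_vars in w1.
rewrite (ev_nonlin (cK j) w1) /=.
under eq_bigr do rewrite (evZ _ z1 (yr _)) mxE.
set A := ev (y j) (fun i => tdil q i * z i); set B := ev (y j) (dpoint q s z); set E := ev (nonlin _) _.
set F := \sum_(k < n) _ => h; transitivity (E - (E - (B - A)) + A); first by ring.
by rewrite -h; ring.
Qed.
End FixedPointEquation.
End Existence.


(** * From holomorphic germs to normalized series *)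

Section Bridge.
Variable R : realType.
Local Notation C := R[i].

Lemma in_polydiscE (I : finType) (p z : I -> C) (r : R) :
  in_polydisc p z r%:C%C <-> forall i, normc (z i - p i) < r.
Proof. by split=> h i; have := h i; rewrite normcE_real ltcR. Qed.

Lemma open_polydisc (I : finType) (p : I -> C) (r : R) :
  open_set (fun z => in_polydisc p z r%:C%C).
Proof.
move=> z /in_polydiscE zp.
have [d d0 hd] : exists2 d, 0 < d &
    forall d', 0 < d' <= d -> forall i, normc (z i - p i) + d' <= r.
  apply: finite_common_radius => i; exists (r - normc (z i - p i)).
    by rewrite subr_gt0.
  by move=> d' /andP[_]; rewrite lerBrDl.
exists d%:C%C; split; first by rewrite ltcR.
move=> z' /in_polydiscE zz'; apply/in_polydiscE => i.
have -> : z' i - p i = (z' i - z i) + (z i - p i) by rewrite subrKA.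
apply: le_lt_trans (le_normcD _ _) _; apply: lt_le_trans (hd d _ i).
  by rewrite addrC ltrD2l.
by rewrite d0 lexx.
Qed.

Lemma multi_pow_neq0 (I : finType) (z : I -> C) (a : I -> nat) :
  (forall i, z i != 0) -> multi_pow z a != 0.
Proof. by move=> z0; apply/prodf_neq0 => i _; rewrite expf_neq0. Qed.

Lemma real_complex_neq0 (r : R) : 0 < r -> r%:C%C != 0 :> C.
Proof. by move=> r0; apply/eqP => -[] /eqP; rewrite gt_eqF. Qed.

Lemma normc_divr (z : C) (r : R) : 0 < r -> normc (z / r%:C%C) = normc z / r.
Proof. by move=> r0; rewrite normcM normcV normc_real_ge0 // ltW. Qed.

Lemma in_unit_divr (I : Type) (z : I -> C) (r : R) : 0 < r ->
  (forall i, normc (z i) <= r) -> forall i, normc (z i / r%:C%C) <= 1.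
Proof. by move=> r0 zr i; rewrite normc_divr // ler_pdivrMr // mul1r. Qed.

(** Splitting off the variable twice gives the Taylor expansion of order one; the remainder is the
    value of a twice shifted series. *)
Lemma ev_first_order (I : finType) (c : mindex I -> C) K i v :
  l1_bound c K -> normc v <= 1 -> exists2 d, normc d <= K &
  ev c (upd zerov i v) = c (zerom I) + v * c (unitm i) + v * v * d.
Proof.
move=> cK v1; pose sh (f : mindex I -> C) := f \o addm (unitm i).
have z1 : in_unit (zerov : I -> C) by move=> j; rewrite /zerov normc0.
have upd0 : upd zerov i 0 = zerov :> (I -> C).
  by apply: funext => j; rewrite /upd /zerov if_same.
have sK := l1_bound_inj (@addm_inj I i) cK.
exists (ev (sh (sh c)) (upd zerov i v)).
  apply: normc_ev; first exact: in_unit_upd.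
  exact: (l1_bound_inj (@addm_inj I i) sK).
rewrite (ev_upd i cK z1 v1) (ev_upd i sK z1 v1) upd0 !ev_at0 mulrDr mulrA addrA.
congr (_ + _ * c _ + _); apply/ffunP => j.
by rewrite !ffunE addn0.
Qed.

Lemma holomorphic_unit_scale (I : finType) (f : (I -> C) -> C) (p : I -> C) :
  holomorphic_at f p -> exists2 r, 0 < r & forall rho, 0 < rho <= r ->
  exists c K, l1_bound c K /\
    forall w, in_unit w -> f (fun i => p i + rho%:C%C * w i) = ev c w.
Proof.
move=> [c [r [/gt0_complexE[rE r0] conv]]]; rewrite rE in conv.
(* Half the radius puts the closed polydisc inside the open one. Absolute convergence at the corner
   [(rho, ..., rho)] is then the norm bound for the rescaled coefficients. *)
exists (complex.Re r / 2); first by rewrite divr_gt0.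
move=> rho /andP[rho0 rhor].
have cv w : in_unit w -> ps_converges_to c (fun i => rho%:C%C * w i)
    (f (fun i => p i + rho%:C%C * w i)).
  move=> w1; have -> : (fun i => rho%:C%C * w i) = (fun i => (p i + rho%:C%C * w i) - p i).
    by apply: funext => i; rewrite addrC addKr.
  apply: conv; apply/in_polydiscE => i; rewrite addrC addKr normcM.
  rewrite normc_real_ge0 ?ltW //; have := w1 i; have := normc_ge0 (w i).
  set x := normc _ => x0 x1; nra.
exists (fun a : mindex I => c a * multi_pow (fun=> rho%:C%C) a).
have /cv/ps_converges_toE[[K cK] _] : in_unit (fun _ : I => 1 : C).
  by move=> i; rewrite normc1.
exists K; split.
  apply: l1_bound_le cK _ _ => // a; rewrite /terms.
  by rewrite (_ : (fun _ : I => rho%:C%C * 1) = (fun=> rho%:C%C)) //; apply: funext => i; rewrite mulr1.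
by move=> w /cv /ps_converges_to_scaled.
Qed.
End Bridge.

(** * Local solutions and uniqueness near a parameter *)

Section Local.
Variables (R : realType) (m n : nat).
Local Notation C := R[i].
Local Notation J := (('I_m + 'I_n) + 'I_m)%type.
Local Notation S := ('I_m + 'I_m)%type.
Variables (U : ('I_m -> C) -> Prop).
Variable (H : ('I_m -> C) -> ('I_n -> C) -> ('I_m -> C) -> 'I_n -> C).
Hypothesis U_open : open_set U.
Hypothesis U_disc : forall q, U q -> forall i, `|q i| < 1.
Hypothesis H_hol : forall q0, U q0 -> forall j, holomorphic_at (H3 H j) (join3 zerov zerov q0).
Hypothesis H_0 : forall q0, U q0 -> forall j, H zerov zerov q0 j = 0.
Hypothesis H_eig : forall q, U q -> forall D : 'M[C]_n,
  (forall j k, is_partial_y H q j k (D j k)) ->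
  forall lam, eigenvalue D lam -> ~ in_Q0 q lam.

Let q_lt1 q : U q -> forall i, normc (q i) < 1.
Proof. by move=> Uq i; have := U_disc Uq i; rewrite normcE_real ltcR. Qed.

(** Scaling [y] and the values of [H] by the same [rho] preserves both the form of the equation and
    its Jacobian in [y]. *)
Lemma normal_form q0 : U q0 -> exists (rho : R) (c : 'I_n -> mindex J -> C) (K : R),
  [/\ 0 < rho, 0 < K, forall j, l1_bound (c j) K,
      forall s, in_unit s -> U (fun i => q0 i + rho%:C%C * s i) &
      forall t y s, in_unit (join3 t y s) -> forall j,
        H (fun i => rho%:C%C * t i) (fun k => rho%:C%C * y k)
          (fun i => q0 i + rho%:C%C * s i) j = rho%:C%C * ev (c j) (join3 t y s)].
Proof.
move=> Uq; have [rU [rU0 hU]] := U_open Uq; have [rE r0] := gt0_complexE rU0.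
have [r1 r10 hr1] := finite_common_radius (fun j => holomorphic_unit_scale (H_hol Uq j)).
pose rho := Num.min (complex.Re rU / 2) r1.
have rho0 : 0 < rho by rewrite lt_min divr_gt0.
have /hr1/choice[c hc] : 0 < rho <= r1 by rewrite rho0 ge_min lexx orbT.
have [k hk] := choice hc.
pose c' j g := (rho^-1)%:C%C * c j g.
have [K K0 cK] : exists2 K, 0 < K & forall j, l1_bound (c' j) K.
  apply: finite_common_bound => [j K1 K2 h|j]; first exact: l1_boundW.
  by exists (normc (rho^-1)%:C%C * k j); apply: l1_boundZ; case: (hk j).
exists rho, c', K; split=> //.
  move=> s s1; apply: hU; rewrite rE; apply/in_polydiscE => i.
  rewrite addrC addKr normcM normc_real_ge0 ?ltW //.
  have : rho <= complex.Re rU / 2 by rewrite ge_min lexx.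
  have := s1 i; have := normc_ge0 (s i); set x := normc _ => x0 x1; nra.
move=> t y s w1 j; have [ck /(_ _ w1) E] := hk j.
rewrite (evZ _ w1 ck) -E mulrA -rmorphM /= mulfV ?gt_eqF // mul1r /H3 /=.
by congr (H _ _ _ j); apply: funext => i; rewrite /zerov add0r.
Qed.

Section AtPoint.
Variables (q0 : 'I_m -> C) (rho : R) (c : 'I_n -> mindex J -> C) (K : R).
Hypotheses (Uq0 : U q0) (rho0 : 0 < rho) (K0 : 0 < K) (cK : forall j, l1_bound (c j) K).
Hypothesis U_nbhs : forall s, in_unit s -> U (fun i => q0 i + rho%:C%C * s i).
Hypothesis H_c : forall t y s, in_unit (join3 t y s) -> forall j,
  H (fun i => rho%:C%C * t i) (fun k => rho%:C%C * y k)
    (fun i => q0 i + rho%:C%C * s i) j = rho%:C%C * ev (c j) (join3 t y s).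

Let rhoC : rho%:C%C != 0 :> C := real_complex_neq0 rho0.

Let mul0f (I : Type) : (fun _ : I => rho%:C%C * 0) = zerov :> (I -> C).
Proof. by apply: funext => i; rewrite mulr0. Qed.

Let addq0 : (fun i => q0 i + rho%:C%C * zerov i) = q0.
Proof. by apply: funext => i; rewrite mulr0 addr0. Qed.

Let c_vanish v : in_unit v -> forall j, ev (c j) (join3 zerov zerov v) = 0.
Proof.
move=> v1 j; have w1 : in_unit (join3 (zerov : 'I_m -> C) (zerov : 'I_n -> C) v).
  by move=> [[i|i]|i]; rewrite /join3 /zerov ?normc0 //; exact: v1.
have := H_c w1 j; rewrite /zerov !mul0f H_0; last exact: U_nbhs.
by move=> /esym/eqP; rewrite mulf_eq0 (negPf rhoC) => /eqP.
Qed.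

(** Identifies the matrix of linear coefficients with [D(q0)], so that the eigenvalue hypothesis
    bears on it. *)
Let partial_y j k : is_partial_y H q0 j k (linpart c j k).
Proof.
move=> e /gt0_complexE[-> e0]; set e' := complex.Re e in e0 *.
(* With [v = h / rho], the difference quotient misses the linear coefficient by [v * x], where [x]
   is bounded by [K]. *)
have [d [d0 d1 hd _]] := small_radius K 0 e0 ltr01 ltr01.
exists (rho * d)%:C%C; split; first by rewrite ltcR mulr_gt0.
move=> h /andP[h0]; rewrite normcE_real ltcR => hd'.
have hne : h != 0 by apply: contraTneq h0 => ->; rewrite normr0 ltxx.
pose v := h / rho%:C%C.
have vd : normc v < d by rewrite normc_divr // ltr_pdivrMr // mulrC.
have v1 : normc v <= 1 by apply: le_trans (ltW vd) d1.
have wE : join3 zerov (fun l => if l == k then v else 0) zerov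
    = upd zerov (yvar m k) v :> (J -> C).
  by apply: funext => -[[i|l]|i].
have w1 : in_unit (join3 zerov (fun l => if l == k then v else 0) zerov : J -> C).
  by rewrite wE; apply: in_unit_upd => // i; rewrite /zerov normc0.
have HE := H_c w1 j; rewrite addq0 mul0f in HE.
have hE : (fun l : 'I_n => rho%:C%C * (if l == k then v else 0)) = (fun l => if l == k then h else 0).
  by apply: funext => l; case: eqP => _; rewrite ?mulr0 // mulrC divfK.
rewrite hE wE in HE; rewrite HE H_0 // subr0.
have [x xK ->] := ev_first_order (yvar m k) (cK j) v1.
have -> : c j (zerom J) = 0.
  rewrite -ev_at0 (_ : zerov = join3 zerov zerov zerov) ?c_vanish //.
    by move=> i; rewrite /zerov normc0.
  by apply: funext => -[[i|i]|i].
rewrite mxE normcE_real ltcR.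
have -> : rho%:C%C * (0 + v * c j (unitm (yvar m k)) + v * v * x) / h - c j (unitm (yvar m k))
    = v * x.
  by rewrite /v; field; rewrite hne rhoC.
rewrite normcM; apply: lt_le_trans hd.
apply: le_lt_trans (ler_wpM2l (normc_ge0 v) xK) _.
by rewrite mulrC ltr_pM2l.
Qed.

Let D_eig lam : in_Q0 q0 lam -> ~~ eigenvalue (linpart c) lam.
Proof. by move=> h; apply/negP => ev; exact: (H_eig Uq0 partial_y ev h). Qed.

Let D_eig_pow (a : mindex 'I_m) : a != zerom _ -> ~~ eigenvalue (linpart c) (multi_pow q0 a).
Proof.
move=> a0; apply: D_eig; right; exists a; split=> //.
have : [exists i, a i != 0%N].
  apply: contraNT a0; rewrite negb_exists => /forallP h.
  by apply/eqP/ffunP => i; rewrite ffunE; apply/eqP; move: (h i); rewrite negbK.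
by case/existsP => i /eqP ai; exists i.
Qed.

Let resolvent_bd : exists2 Kr, 0 < Kr & forall a : mindex 'I_m, a != zerom _ ->
    forall j k, normc (resolvent (linpart c) (multi_pow q0 a) j k) <= Kr.
Proof.
apply: resolvent_bounded; [exact: q_lt1| |exact: D_eig_pow].
by apply: D_eig; left.
Qed.

Definition join2 (t s : 'I_m -> C) : S -> C :=
  fun i => match i with inl k => t k | inr k => s k end.

Lemma local_family : exists (tau sigma : R) (y : 'I_n -> mindex S -> C) (Ky : R),
  [/\ 0 < tau, 0 < sigma, forall j, l1_bound (y j) Ky,
      forall q, (forall i, normc (q i - q0 i) <= sigma) -> U q &
      let Y j t q := ev (y j) (join2 (fun i => t i / tau%:C%C)
                                     (fun i => (q i - q0 i) / sigma%:C%C)) in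
      forall t q, (forall i, normc (t i) <= tau) ->
        (forall i, normc (q i - q0 i) <= sigma) -> forall j,
        Y j zerov q = 0 /\ Y j (fun i => q i * t i) q = H t (fun k => Y k t q) q j].
Proof.
have [Kr Kr0 DKr] := resolvent_bd.
have [x [x0 x1 qx]] := radius_below1 (q_lt1 Uq0).
have h8 : 0 < (8 : R)^-1 by rewrite invr_gt0.
have h2 : 0 < (2 : R)^-1 by rewrite invr_gt0.
(* The nonlinear part and the dilation term are each allotted [8^-1] of the admissible [2^-1]. *)
have [r [r0 r2 hr _]] := small_radius (n%:R * Kr * (K * 2)) 0 h8 ltr01 h2.
(* The midpoint between [x] and [1]: then [rho * rs <= 1 - theta] yields [x + rho * rs <= theta]. *)
pose theta := (1 + x) / 2.
have th1 : theta < 1 by rewrite /theta; lra.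
have g0 : 0 < 1 - theta by rewrite subr_gt0.
have [rs [rs0 rsr hs1 hs2]] := small_radius rho (n%:R * Kr * (rho / (1 - theta))) g0 h8 r0.
have r20 : 0 < r / 2 by rewrite divr_gt0.
have [rt [rt0 rtr ht _]] := small_radius (n%:R * Kr * K) 0 r20 ltr01 r0.
pose s := rho * rs; have s0 : 0 < s by rewrite mulr_gt0.
have qs i : normc (q0 i) + s <= theta.
  by apply: le_trans (lerD (qx i) hs1) _; rewrite /theta; lra.
have [||||y [yr y0 yE]] := @scaled_solution_exists _ _ _ c K Kr r rt rs s theta q0
   cK D_eig_pow (ltW Kr0) DKr r0 r2 _ _ (ltW s0) th1 qs _ _ c_vanish.
- by rewrite ltW.
- by rewrite ltW.
- have E : n%:R * Kr * (rho / (1 - theta)) * rs = n%:R * Kr * (s / (1 - theta)).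
    by rewrite /s; ring.
  rewrite E in hs2; move: hr hs2; set A := n%:R * Kr; set B := s / _ => hr hs2.
  have -> : A * (K * (2 * r) + B) = A * (K * 2) * r + A * B by ring.
  lra.
- by rewrite mulrA.
exists (rho * rt), s, (fun j a => rho%:C%C * y j a), (rho * r).
have tau0 : 0 < rho * rt by rewrite mulr_gt0.
have tauC := real_complex_neq0 tau0; have sC := real_complex_neq0 s0.
have yb j := l1_boundZ rho%:C%C (yr j).
have r1 : r <= 1 by lra.
split=> //.
- by move=> j; have := yb j; rewrite normc_real_ge0 // ltW.
- move=> q qq; have -> : q = (fun i => q0 i + rho%:C%C * ((q i - q0 i) / rho%:C%C)).
    by apply: funext => i; rewrite mulrC divfK // addrC subrK.
  apply: U_nbhs; apply: (@in_unit_divr _ _ (fun i => q i - q0 i)) => // k; apply: le_trans (qq k) _.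
  by rewrite /s ler_piMr ?ltW //; lra.
move=> Y t q tt qq j.
pose z t := join2 (fun i => t i / (rho * rt)%:C%C) (fun i => (q i - q0 i) / s%:C%C).
have z1 u : (forall i, normc (u i) <= rho * rt) -> in_unit (z u).
  move=> ut [i|i]; first exact: (in_unit_divr tau0 ut).
  exact: (@in_unit_divr _ _ (fun i => q i - q0 i)).
have YE u k : (forall i, normc (u i) <= rho * rt) -> Y k u q = rho%:C%C * ev (y k) (z u).
  by move=> ut; rewrite /Y (evZ _ (z1 u ut) (yr k)).
have z0 : z zerov = tzero (z t).
  by apply: funext => -[i|i] //; rewrite /z /tzero /= /zerov mul0r.
split.
  rewrite YE ?z0 ?y0 ?mulr0 //; first exact: z1.
  by move=> i; rewrite /zerov normc0 ltW.
have q1 i : normc (q i) <= 1.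
  have -> : q i = q0 i + (q i - q0 i) by rewrite addrC subrK.
  apply: le_trans (le_normcD _ _) _; apply: le_trans (ltW th1).
  by apply: le_trans (qs i); rewrite lerD2l.
have qt i : normc (q i * t i) <= rho * rt.
  by rewrite normcM; apply: le_trans (tt i); rewrite ler_piMl ?normc_ge0.
rewrite YE //.
have -> : z (fun i => q i * t i) = dpoint q0 s (z t).
  apply: funext => -[i|i] //=.
  by rewrite [s%:C%C * _]mulrC divfK // [q0 i + _]addrC subrK mulrA.
rewrite (yE _ _ (z1 t tt)).
rewrite -H_c; last first.
  move=> [[i|k]|i]; rewrite /join3.
  - rewrite normcM (normc_real_ge0 (ltW rt0)).
    apply: mulr_ile1; [exact: ltW|exact: normc_ge0|lra|exact: (z1 t tt (inl i))].
  - by apply: le_trans (normc_ev (z1 t tt) (yr k)) _.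
  - rewrite normcM (normc_real_ge0 (ltW rs0)).
    apply: mulr_ile1; [exact: ltW|exact: normc_ge0|lra|exact: (z1 t tt (inr i))].
congr (H _ _ _ j).
- apply: funext => i /=; rewrite mulrA -rmorphM /= mulrC divfK //.
- by apply: funext => k; rewrite YE.
- by apply: funext => i /=; rewrite mulrA -rmorphM /= -/s mulrC divfK // addrC subrK.
Qed.

(** The coefficients of [y(rho * rt * z) / rho] as a series in [z]. *)
Let rescale (b : 'I_n -> ('I_m -> nat) -> C) (rt : R) j (a : mindex 'I_m) : C :=
  (rho^-1)%:C%C * (b j a * multi_pow (fun=> (rho * rt)%:C%C) a).

(** Shrinking the polydisc from radius [r3] to [eta * r3] multiplies every nonconstant coefficient
    by at most [eta], and the constant one is zero; the norm is thus at most proportional to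
    [rt]. *)
Let rescale_solution (r : R) b : 0 < r <= 2^-1 -> is_solution H q0 b ->
  exists2 rb, 0 < rb & forall rt, 0 < rt <= rb -> rt <= r ->
  scaled_solution c r rt q0 (rescale b rt).
Proof.
move=> /andP[r0 r2] [b0 [rY [Y [/gt0_complexE[rE r1] HY]]]].
set r' := complex.Re rY in rE r1; rewrite rE in HY.
pose r3 := r' / 2; have r30 : 0 < r3 by rewrite divr_gt0.
have [B B0 bB] : exists2 B, 0 < B & forall j,
    l1_bound (fun a : mindex 'I_m => b j a * multi_pow (fun=> r3%:C%C) a) B.
  apply: finite_common_bound => [j K1 K2 h|j]; first exact: l1_boundW.
  have [] := HY (fun=> r3%:C%C).
    apply/in_polydiscE => i; rewrite /zerov subr0 (normc_real_ge0 (ltW r30)).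
    by rewrite /r3; lra.
  by move=> /(_ j)/ps_converges_toE[[k hk] _] _; exists k.
have h2 : 0 < (2 : R)^-1 by rewrite invr_gt0.
(* The conditions ensure [eta <= 2^-1] and norm [rho^-1 * eta * B = B / r3 * rt <= r]. *)
have [rb [rb0 _ hb1 hb2]] := small_radius (rho / r3) (B / r3) h2 r0 ltr01.
exists rb => // rt /andP[rt0 rtb] rtr.
pose eta := rho * rt / r3.
have eta0 : 0 < eta by rewrite divr_gt0 // mulr_gt0.
have eta2 : eta <= 2^-1.
  apply: le_trans hb1; rewrite /eta mulrAC ler_wpM2l // divr_ge0 ?ltW //.
have etaE : rho * rt = eta * r3 by rewrite /eta divfK // gt_eqF.
have ri0 : 0 <= rho^-1 by rewrite invr_ge0 ltW.
have re0 : 0 <= rho^-1 * eta by rewrite mulr_ge0 // ltW.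
have yr j : l1_bound (rescale b rt j) r.
  have h := l1_boundZ (rho^-1 * eta)%:C%C (bB j).
  apply: l1_bound_le h _ _.
    move=> a; rewrite /rescale !normcM.
    rewrite (normc_real_ge0 ri0) (normc_real_ge0 re0) -mulrA ler_wpM2l //.
    have [->|a0] := eqVneq a (zerom _).
      have -> : b j (zerom 'I_m) = 0.
        rewrite -(b0 j); congr (b j _); apply: funext => i; exact: ffunE.
      by rewrite normc0 !mul0r mulr0.
    rewrite mulrCA ler_wpM2l ?normc_ge0 //.
    rewrite (_ : (fun _ : 'I_m => (rho * rt)%:C%C) = (fun=> eta%:C%C * r3%:C%C)); last first.
      by apply: funext => i; rewrite etaE rmorphM.
    rewrite multi_powM normcM ler_wpM2r ?normc_ge0 //.
    (* A nonzero exponent is one outside the box of size [1], which gains the first power of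
       [eta]. *)
    rewrite -[leRHS]expr1; apply: multi_pow_outside_box; [exact: ltW|lra| |].
      by move=> i; rewrite (normc_real_ge0 (ltW eta0)).
    rewrite mem_box; apply: contra a0 => /forallP h'; apply/eqP/ffunP => i.
    by rewrite ffunE; apply/eqP; have := h' i; rewrite ltnS leqn0.
  rewrite (normc_real_ge0 re0).
  have -> : rho^-1 * eta * B = B / r3 * rt.
    by rewrite /eta; field; rewrite !gt_eqF.
  by apply: le_trans hb2; rewrite ler_wpM2l // divr_ge0 ?ltW.
have small (z : 'I_m -> C) : in_unit z -> in_polydisc zerov (fun i => (rho * rt)%:C%C * z i) r'%:C%C.
  move=> z1; apply/in_polydiscE => i; rewrite /zerov subr0 normcM normc_real_ge0; last first.
    by rewrite mulr_ge0 ?ltW.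
  rewrite etaE; apply: (@le_lt_trans _ _ (eta * r3)).
    by rewrite ler_piMr ?z1 // mulr_ge0 ?ltW.
  by rewrite /r3; nra.
have evy (z : 'I_m -> C) j : in_unit z ->
    ev (rescale b rt j) z = (rho^-1)%:C%C * Y j (fun i => (rho * rt)%:C%C * z i).
  move=> z1; have [/(_ j)/[dup] cv /ps_converges_to_scaled <- _] := HY _ (small z z1).
  rewrite /rescale; apply: evZ z1 _.
  have h := l1_boundZ rho%:C%C (yr j); apply: l1_bound_le h _ (lexx _) => a.
  by rewrite /rescale mulrA -rmorphM /= mulfV ?gt_eqF // mul1r.
split=> //.
  move=> j; rewrite /rescale (_ : b j (zerom 'I_m) = 0) ?mul0r ?mulr0 //.
  by rewrite -(b0 j); congr (b j _); apply: funext => i; exact: ffunE.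
move=> z z1 j.
have q01 : in_unit q0 by move=> i; exact: ltW (q_lt1 Uq0 i).
rewrite evy; last exact: in_unitM.
have [_ /(_ j) fe] := HY _ (small z z1).
have -> : (fun i => (rho * rt)%:C%C * (q0 i * z i)) = (fun i => q0 i * ((rho * rt)%:C%C * z i)).
  by apply: funext => i; rewrite mulrCA.
rewrite fe; set w := join3 _ _ _.
have w1 : in_unit w.
  move=> [[i|k]|i]; rewrite /w /join3.
  - rewrite normcM (normc_real_ge0 (ltW rt0)).
    apply: mulr_ile1; [exact: ltW|exact: normc_ge0|lra|exact: z1].
  - by apply: le_trans (normc_ev z1 (yr k)) _; lra.
  - by rewrite /zerov normc0.
have := H_c w1 j; rewrite addq0 => E.
apply: (mulfI rhoC); rewrite -E mulrA -rmorphM /= mulfV ?gt_eqF // mul1r.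
congr (H _ _ _ j); apply: funext => i.
  by rewrite mulrA -rmorphM.
by rewrite evy // mulrA -rmorphM /= mulfV ?gt_eqF // mul1r.
Qed.

Lemma solution_unique b b' : is_solution H q0 b -> is_solution H q0 b' ->
  forall j a, b j a = b' j a.
Proof.
move=> sb sb' j a.
have [Kr Kr0 DKr] := resolvent_bd.
have h2 : 0 < (2 : R)^-1 by rewrite invr_gt0.
have [r [r0 r2 hr _]] := small_radius (n%:R * Kr * (K * 2)) 0 h2 ltr01 h2.
have rr : 0 < r <= 2^-1 by rewrite r0.
have [r1 r10 s1] := rescale_solution rr sb.
have [r1' r10' s1'] := rescale_solution rr sb'.
pose rt := Num.min r (Num.min r1 r1').
have rt0 : 0 < rt by rewrite !lt_min r0 r10.
have rtr : rt <= r by rewrite ge_min lexx.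
have {}s1 := s1 rt; have {}s1' := s1' rt.
have l1 : rt <= r1 by rewrite !ge_min lexx !orbT.
have l1' : rt <= r1' by rewrite !ge_min lexx !orbT.
have S1 := s1 (introT andP (conj rt0 l1)) rtr.
have S1' := s1' (introT andP (conj rt0 l1')) rtr.
have q01 : in_unit q0 by move=> i; exact: ltW (q_lt1 Uq0 i).
have := scaled_solution_unique cK q01 D_eig_pow (ltW Kr0) DKr _ _ _ S1 S1' j [ffun i => a i].
have -> : 0 <= r <= 2^-1 by rewrite ltW.
have -> : 0 <= rt <= r by rewrite ltW.
have -> : n%:R * Kr * (K * (2 * r)) <= 2^-1 by rewrite !mulrA in hr *.
move=> /(_ isT isT isT); rewrite /rescale.
have -> : fun_of_fin [ffun i => a i] = a by apply: funext => i; rewrite ffunE.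
have rt1 : 0 < rho * rt by rewrite mulr_gt0.
have ri : 0 < rho^-1 by rewrite invr_gt0.
by move/(mulfI (real_complex_neq0 ri))/(mulIf (multi_pow_neq0 _ (fun=> real_complex_neq0 rt1))).
Qed.
End AtPoint.
End Local.


(** * Slices at fixed parameters and recentring *)

Section Family.
Variables (R : realType) (m : nat).
Local Notation C := R[i].
Local Notation S := ('I_m + 'I_m)%type.
Variables (q0 : 'I_m -> C) (tau sigma : R) (y : mindex S -> C) (K : R).
Hypotheses (tau0 : 0 < tau) (sigma0 : 0 < sigma) (yK : l1_bound y K).

Definition chart (t q : 'I_m -> C) : S -> C :=
  join2 (fun i => t i / tau%:C%C) (fun i => (q i - q0 i) / sigma%:C%C).

(** Fixing [q] is a substitution: the [t]-variables go to themselves and the [s]-variables to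
    constants, of modulus at most one as long as [q] is within [sigma] of [q0]. *)
Definition slice (q : 'I_m -> C) : mindex 'I_m -> C :=
  compps y (fun w => match w with
    | inl i => monom 1 (unitm i)
    | inr i => monom ((q i - q0 i) / sigma%:C%C) (zerom _) end).

(** Powers of the inverse of [tau] undo the scaling of [t]; the factor [1] matches the form of
    [ev_ps_converges_to]. *)
Definition slice_coef (q : 'I_m -> C) (a : 'I_m -> nat) : C :=
  1 * (slice q [ffun i => a i] * multi_pow (fun=> (tau%:C%C)^-1) a).

Variable q : 'I_m -> C.
Hypothesis qs : forall i, normc (q i - q0 i) <= sigma.

Let vars_bound w : l1_bound (match w with
    | inl i => monom 1 (unitm i)
    | inr i => monom ((q i - q0 i) / sigma%:C%C) (zerom 'I_m) end) 1.
Proof.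
case: w => i; first by rewrite -(@normc1 R); exact: l1_bound_monom.
apply: l1_boundW (l1_bound_monom _ _) _.
exact: (@in_unit_divr _ _ (fun i => q i - q0 i)).
Qed.

Lemma l1_bound_slice : l1_bound (slice q) K.
Proof. exact: (l1_bound_compps yK vars_bound). Qed.

Lemma ev_slice z : in_unit z ->
  ev (slice q) z = ev y (join2 z (fun i => (q i - q0 i) / sigma%:C%C)).
Proof.
move=> z1; rewrite (ev_compps yK vars_bound z1); congr ev; apply: funext => -[i|i].
  by rewrite ev_monom multi_pow_unit mul1r.
by rewrite ev_monom multi_pow0 mulr1.
Qed.

Lemma slice_converges t : (forall i, normc (t i) <= tau) ->
  ps_converges_to (slice_coef q) t (ev y (chart t q)).
Proof.
move=> tt; have t1 := in_unit_divr tau0 tt.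
rewrite /chart -(ev_slice t1) -[ev _ _]mul1r.
by apply: (ev_ps_converges_to 1 l1_bound_slice t1) => i; rewrite mulrC.
Qed.

Lemma slice_coef0 : ev y (chart zerov q) = 0 -> slice_coef q (fun=> 0%N) = 0.
Proof.
rewrite /chart (_ : (fun i => zerov i / tau%:C%C) = zerov); last first.
  by apply: funext => i; rewrite /zerov mul0r.
rewrite -ev_slice; last by move=> i; rewrite /zerov normc0.
rewrite ev_at0 /slice_coef => h.
by rewrite (_ : [ffun i => 0%N] = zerom 'I_m) ?h ?mul0r ?mulr0.
Qed.

Lemma slice_box_sum t N : (forall i, normc (t i) <= tau / 2) ->
  normc (box_sum (slice_coef q) t N - ev y (chart t q)) <= K * 2^-1 ^+ N.
Proof.
move=> tt; have t2 i : normc (t i / tau%:C%C) <= 2^-1.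
  by rewrite normc_divr // ler_pdivrMr // mulrC.
have t1 : in_unit (fun i => t i / tau%:C%C).
  by move=> i; apply: le_trans (t2 i) _; lra.
rewrite /chart -(ev_slice t1); have := box_tail N l1_bound_slice t2.
rewrite box_sumE; set A := \sum_(_ <- _) _; set B := \sum_(_ <- _) _.
suff -> : A = B by []; apply: eq_bigr => a _.
rewrite /terms /slice_coef mul1r ffunK multi_powM -mulrA; congr (_ * _).
exact: mulrC.
Qed.
End Family.

(** The chart is affine, so recentring at [w] substitutes [ch w i + e v_i] for the [i]-th variable;
    an [e] with [normc (ch w i) + e <= 1] keeps these series of norm at most one. *)
Lemma family_holomorphic (R : realType) m (q0 : 'I_m -> R[i]) (tau sigma : R)
  (y : mindex ('I_m + 'I_m)%type -> R[i]) K (w : ('I_m + 'I_m)%type -> R[i]) :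
  0 < tau -> 0 < sigma -> l1_bound y K ->
  (forall i, normc (w (inl i)) < tau) -> (forall i, normc (w (inr i) - q0 i) < sigma) ->
  holomorphic_at (fun w' => ev y (chart q0 tau sigma (fun i => w' (inl i)) (fun i => w' (inr i)))) w.
Proof.
move=> tau0 sigma0 yK wt wq.
pose ch w' := chart q0 tau sigma (fun i => w' (inl i)) (fun i => w' (inr i)).
pose scale (i : 'I_m + 'I_m) := if i is inl _ then tau else sigma.
have scale0 i : 0 < scale i by case: i.
have chB w' i : ch w' i - ch w i = (w' i - w i) / (scale i)%:C%C.
  by case: i => i; rewrite /ch /chart /= -mulrBl // opprB addrA subrK.
have P1 i : normc (ch w i) < 1.
  by case: i => i; rewrite /ch /chart /join2 normc_divr // ltr_pdivrMr // mul1r.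
have [e e0 /(_ e)] : exists2 e, 0 < e & forall e', 0 < e' <= e -> forall i, normc (ch w i) + e' <= 1.
  apply: finite_common_radius => i; exists (1 - normc (ch w i)); first by rewrite subr_gt0.
  by move=> d' /andP[_]; rewrite lerBrDl.
rewrite e0 lexx => /(_ isT) Pe.
have eC := real_complex_neq0 e0.
pose x i a := monom (ch w i) (zerom _) a + monom e%:C%C (unitm i) a.
have x1 i : l1_bound (x i) 1.
  apply: l1_boundW (l1_boundD (l1_bound_monom _ _) (l1_bound_monom _ _)) _.
  by rewrite (normc_real_ge0 (ltW e0)).
pose lam i := ((e * scale i)%:C%C)^-1 : R[i].
exists (fun a => 1 * (compps y x [ffun i => a i] * multi_pow lam a)).
exists (e * Num.min tau sigma)%:C%C; split.
  by rewrite ltcR mulr_gt0 // lt_min tau0.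
move=> z /in_polydiscE zw.
pose v i := lam i * (z i - w i).
have es i : 0 < e * scale i by rewrite mulr_gt0.
have v1 : in_unit v.
  move=> i; rewrite /v mulrC; have -> : (z i - w i) * lam i = (z i - w i) / (e * scale i)%:C%C by [].
  rewrite normc_divr // ler_pdivrMr // mul1r; apply: le_trans (ltW (zw i)) _.
  by rewrite ler_pM2l //; case: i {zw} => i /=; rewrite ge_min lexx ?orbT.
have -> : ev y (ch z) = 1 * ev (compps y x) v.
  rewrite mul1r (ev_compps yK x1 v1); congr ev; apply: funext => i.
  rewrite (evD v1 (l1_bound_monom _ _) (l1_bound_monom _ _)) !ev_monom multi_pow0 mulr1.
  rewrite multi_pow_unit; apply/eqP; rewrite addrC -subr_eq chB; apply/eqP.
  rewrite /v /lam rmorphM /=; have := real_complex_neq0 (scale0 i).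
  set X := (scale i)%:C%C; set Y := e%:C%C => X0.
  by field; rewrite X0 eC.
exact: (ev_ps_converges_to 1 (l1_bound_compps yK x1) v1).
Qed.

Theorem mainTheorem11 (R : realType) (m n : nat)
  (U : ('I_m -> R[i]) -> Prop)
  (H : ('I_m -> R[i]) -> ('I_n -> R[i]) -> ('I_m -> R[i]) -> 'I_n -> R[i]) :
  (1 <= m)%N -> (1 <= n)%N ->
  open_set U ->
  (forall q, U q -> forall i, `|q i| < 1) ->
  (forall q0, U q0 -> forall j, holomorphic_at (H3 H j) (join3 (zerov) (zerov) q0)) ->
  (forall q0, U q0 -> forall j, H (zerov) (zerov) q0 j = 0) ->
  (forall q, U q -> forall D : 'M[R[i]]_n,
      (forall j k, is_partial_y H q j k (D j k)) ->
      forall lam, eigenvalue D lam -> ~ in_Q0 q lam) ->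
  exists b : ('I_m -> R[i]) -> 'I_n -> ('I_m -> nat) -> R[i],
    (forall q, U q ->
       is_solution H q (b q) /\
       (forall b', is_solution H q b' -> forall j a, b' j a = b q j a)) /\
    (forall q0, U q0 ->
       exists (Z V : ('I_m -> R[i]) -> Prop),
         open_set Z /\ Z (zerov) /\ open_set V /\ V q0 /\ (forall q, V q -> U q) /\
         exists Y : 'I_n -> ('I_m -> R[i]) -> ('I_m -> R[i]) -> R[i],
           (forall e : R[i], 0 < e -> exists N0 : nat, forall N : nat, (N0 <= N)%N ->
              forall t q, Z t -> V q -> forall j, `|box_sum (b q j) t N - Y j t q| < e) /\
           (forall j (w : ('I_m + 'I_m)%type -> R[i]),
              Z (fun i => w (inl i)) -> V (fun i => w (inr i)) ->
              holomorphic_at (fun w' => Y j (fun i => w' (inl i)) (fun i => w' (inr i))) w)).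
Proof.
move=> _ _ U_open U_disc H_hol H_0 H_eig.
have uniq_sol q b1 b2 : U q -> is_solution H q b1 -> is_solution H q b2 ->
    forall j a, b1 j a = b2 j a.
  move=> Uq; have [rho [c [K [rho0 K0 cK Un Hc]]]] := normal_form U_open H_hol Uq.
  exact: (solution_unique U_disc H_0 H_eig Uq rho0 K0 cK Un Hc).
have family q0 : U q0 -> exists (tau sigma : R) (y : 'I_n -> mindex ('I_m + 'I_m)%type -> R[i]) K,
    [/\ 0 < tau, 0 < sigma, forall j, l1_bound (y j) K,
        forall q, (forall i, normc (q i - q0 i) <= sigma) -> U q &
        forall q, (forall i, normc (q i - q0 i) <= sigma) ->
          is_solution H q (fun j => slice_coef q0 tau sigma (y j) q)].
  move=> Uq; have [rho [c [K [rho0 K0 cK Un Hc]]]] := normal_form U_open H_hol Uq.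
  have [tau [sigma [y [Ky [tau0 sigma0 yK UV yE]]]]] :=
    local_family U_disc H_0 H_eig Uq rho0 K0 cK Un Hc.
  exists tau, sigma, y, Ky; split=> // q qs; have z0 (i : 'I_m) : normc (zerov i : R[i]) <= tau.
    by rewrite /zerov normc0 ltW.
  split=> [j|].
    by apply: (slice_coef0 sigma0 (yK j) qs); case: (yE zerov q z0 qs j).
  exists tau%:C%C, (fun j t => ev (y j) (chart q0 tau sigma t q)).
  split; first by rewrite ltcR.
  move=> t /in_polydiscE tt; have {}tt i : normc (t i) <= tau.
    by have := tt i; rewrite /zerov subr0 => /ltW.
  split=> j; first exact: (slice_converges tau0 sigma0 (yK j)).
  by case: (yE t q tt qs j).
(* Coefficients are chosen separately for each [q], using the family centred at [q] itself; the zero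
   family is a default value outside [U]. *)
have sol q : exists b, U q -> is_solution H q b.
  have [Uq|nU] := pselect (U q); last by exists (fun _ _ => 0).
  have [tau [sigma [y [K [_ sigma0 _ _ ys]]]]] := family q Uq.
  exists (fun j => slice_coef q tau sigma (y j) q) => _; apply: ys => i.
  by rewrite subrr normc0 ltW.
have [b hb] := choice sol; exists b; split=> [q Uq|q0 Uq0].
  by split=> [|b' sb']; [exact: hb|exact: uniq_sol Uq sb' (hb q Uq)].
have [tau [sigma [y [K [tau0 sigma0 yK UV ys]]]]] := family q0 Uq0.
(* Halving [tau] gives the rate [2^-1 ^+ N] for the box sums, uniformly in [t] and [q]. *)
exists (fun t => in_polydisc zerov t (tau / 2)%:C%C), (fun q => in_polydisc q0 q sigma%:C%C).
have VU q : in_polydisc q0 q sigma%:C%C -> forall i, normc (q i - q0 i) <= sigma.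
  by move=> /in_polydiscE h i; exact: ltW.
have Zt t : in_polydisc zerov t (tau / 2)%:C%C -> forall i, normc (t i) < tau / 2.
  by move=> /in_polydiscE h i; have := h i; rewrite /zerov subr0.
split; first exact: open_polydisc.
split; first by apply/in_polydiscE => i; rewrite subrr normc0 divr_gt0.
split; first exact: open_polydisc.
split; first by apply/in_polydiscE => i; rewrite subrr normc0.
split; first by move=> q /VU; exact: UV.
exists (fun j t q => ev (y j) (chart q0 tau sigma t q)); split; last first.
  move=> j w /Zt wt /in_polydiscE wq; apply: family_holomorphic => // i.
  by apply: lt_trans (wt i) _; lra.
move=> e /gt0_complexE[-> e0]; set e' := complex.Re e in e0 *.
have h0 : (0 : R) <= 2^-1 by rewrite invr_ge0.
have h1 : (2^-1 : R) < 1 by lra.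
have h2 : 0 < e' / (`|K| + 1) by rewrite divr_gt0 // ltr_wpDl.
have [N0 hN0] := exp_small h0 h1 h2.
exists N0 => N hN t q /Zt tt /VU qs j; rewrite normcE_real ltcR.
(* Uniqueness at [q] identifies the pointwise choice with the slice of the family around [q0], hence
   the local families agree on overlaps. *)
have -> : b q j = slice_coef q0 tau sigma (y j) q.
  apply: funext => a; exact: (uniq_sol q _ _ (UV q qs) (hb q (UV q qs)) (ys q qs)).
apply: le_lt_trans (slice_box_sum tau0 sigma0 (yK j) qs N (fun i => ltW (tt i))) _.
have hN' : (2^-1 : R) ^+ N <= e' / (`|K| + 1).
  by apply: le_trans hN0; rewrite ler_wiXn2l // ltW.
have K0 := l1_bound_ge0 (yK j); rewrite ger0_norm // in hN'.
apply: le_lt_trans (ler_wpM2l K0 hN') _.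
by rewrite mulrA ltr_pdivrMr ?ltr_wpDl // mulrC ltr_pM2l // ltrDl.
Qed.
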